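(* Let $(M,H)$ be an $n$-dimensional Carnot manifold with weight sequence $(w_1,\ldots,w_n)$, let $(X_1,\ldots,X_n)$ be an $H$-frame near a point $a\in M$, and let $x=(x_1,\ldots,x_n)$ be local coordinates near $a$. Then the change of coordinates $x\mapsto\psi_a(x)$ provides us with privileged coordinates at $a$ that are adapted to the $H$-frame $(X_1,\ldots,X_n)$.
   Context: A Carnot manifold of step $r$ is a pair $(M,H)$, where $M$ is a smooth manifold and $H=(H_1,\ldots,H_r)$ is a filtration of subbundles $H_1\subset\cdots\subset H_r=TM$ such that Lie brackets of sections of $H_w$ and $H_{w'}$ are sections of $H_{w+w'}$ whenever $w+w'\le r$. With $n=\dim M$, its weight sequence is $w_j=\min\{w\in\{1,\ldots,r\}:\ j\le\operatorname{rk}H_w\}$, $j=1,\ldots,n$. An $H$-frame over an open set is a tangent frame $(X_1,\ldots,X_n)$ such that each $X_j$ is a section of $H_{w_j}$. For a finite sequence $I=(i_1,\ldots,i_k)$ in $\{1,\ldots,n\}$ set $X_I=X_{i_1}\cdots X_{i_k}$ and $\langle I\rangle=w_{i_1}+\cdots+w_{i_k}$. A smooth function $f$ near $a$ has order $\ge N$ at $a$ ($N$ a non-negative integer) if $X_If(a)=0$ whenever $\langle I\rangle<N$; it has order $N$ if moreover $X_If(a)\neq0$ for some $I$ with $\langle I\rangle=N$. Local coordinates centered at $a$ are linearly adapted at $a$ to $(X_1,\ldots,X_n)$ if, in these coordinates, $X_j(0)=\partial_j$ for $j=1,\ldots,n$. They are privileged coordinates at $a$ adapted to $(X_1,\ldots,X_n)$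 if they are linearly adapted and, for every $k$, the coordinate function $x_k$ has order $w_k$ at $a$. For $\alpha\in\mathbb{N}_0^n$: $|\alpha|=\alpha_1+\cdots+\alpha_n$ and $\langle\alpha\rangle=w_1\alpha_1+\cdots+w_n\alpha_n$. Definition of $\psi_a$. Identify $a$ with its coordinate vector. Write $X_j=\sum_k b_{jk}(x)\partial_{x_k}$ and $B(x)=(b_{jk}(x))$. The map $T_a(x)=(B(a)^t)^{-1}(x-a)$ is the unique affine change of coordinates giving coordinates centered at $a$ that are linearly adapted to $(X_1,\ldots,X_n)$. Let $\hat\psi_a$ be the unique change of coordinates which transforms the linearly adapted coordinates given by $T_a$ into privileged coordinates at $a$ adapted to $(X_1,\ldots,X_n)$ and has components of the form $x_k+\sum_{\langle\alpha\rangle<w_k,\,|\alpha|\ge2}a_{k\alpha}x^\alpha$ with $a_{k\alpha}\in\mathbb{R}$ (such a map exists and is unique). Then $\psi_a=\hat\psi_a\circ T_a$. *)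

(* Defs.v *)
From HB Require Import structures.
From mathcomp Require Import all_boot all_order all_algebra.
From mathcomp Require Import all_classical all_reals all_analysis.
Set Implicit Arguments.
Unset Strict Implicit.
Unset Printing Implicit Defensive.
Import Order.TTheory GRing.Theory Num.Theory.
Import numFieldNormedType.Exports.
Local Open Scope classical_set_scope.
Local Open Scope ring_scope.

Fixpoint Ck (R : realType) (n : nat) (W : normedModType R) (k : nat)
    (U : set 'rV[R]_n) (f : 'rV[R]_n -> W) : Prop :=
  (forall y, U y -> {for y, continuous f}) /\
  if k is k'.+1 then
    forall i : 'I_n, (forall y, U y -> derivable f y (delta_mx 0 i)) /\
                     Ck k' U ('D_(delta_mx 0 i) f)
  else True.

Definition smooth_on (R : realType) (n : nat) (W : normedModType R)
    (U : set 'rV[R]_n) (f : 'rV[R]_n -> W) : Prop := forall k, Ck k U f.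

(* [cmap] and [cinv] are total functions, meaningful only on [cdom] and on
   its image respectively. *)
Record chart (R : realType) (n : nat) (M : topologicalType) := Chart {
  cdom : set M;
  cmap :> M -> 'rV[R]_n;
  cinv : 'rV[R]_n -> M;
  open_cdom : open cdom;
  open_cimg : open (cmap @` cdom);
  cmapK : forall p, cdom p -> cinv (cmap p) = p;
  cmap_continuous : forall p, cdom p -> {for p, continuous cmap};
  cinv_continuous : forall y, (cmap @` cdom) y -> {for y, continuous cinv}
}.

Definition compatible (R : realType) (n : nat) (M : topologicalType)
    (c d : chart R n M) : Prop :=
  smooth_on (c @` (cdom c `&` cdom d)) (d \o cinv c) /\
  smooth_on (d @` (cdom c `&` cdom d)) (c \o cinv d).

(* The smooth structure is given by an atlas that singles out a chart around
   each point. This makes it possible to represent a tangent vector at [p] by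
   its coordinate vector in the chart [chart_at p], so that T_pM is
   ['rV[R]_n] for every [p], and a vector field is a function
   [M -> 'rV[R]_n]. *)
Record manifold (R : realType) (n : nat) := Manifold {
  mcarrier :> topologicalType;
  chart_at : mcarrier -> chart R n mcarrier;
  mem_chart_at : forall p, cdom (chart_at p) p;
  chart_at_compatible : forall p q, compatible (chart_at p) (chart_at q);
  manifold_hausdorff : hausdorff_space mcarrier;
  manifold_second_countable : @second_countable mcarrier
}.

(* A function [x : M -> 'rV[R]_n] is regarded as local coordinates near [a] if
   it is the coordinate map of some chart of the smooth structure whose domain
   contains [a]; only its germ at [a] matters. *)
Definition local_coords (R : realType) (n : nat) (M : manifold R n) (a : M)
    (x : M -> 'rV[R]_n) : Prop :=
  exists c : chart R n M,
    [/\ cdom c a, forall p, compatible c (chart_at p) & cmap c = x].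

(* df_p(v) for v in T_pM; when [f] is a coordinate map, this is the coordinate
   vector of v in the coordinates [f]. *)
Definition tangent_map (R : realType) (n : nat) (M : manifold R n)
    (W : normedModType R) (f : M -> W) (p : M) (v : 'rV[R]_n) : W :=
  'D_v (f \o cinv (chart_at p)) (chart_at p p).

Definition vf_act (R : realType) (n : nat) (M : manifold R n)
    (X : M -> 'rV[R]_n) (f : M -> R^o) : M -> R^o :=
  fun p => tangent_map f p (X p).

Definition vf_coord (R : realType) (n : nat) (M : manifold R n)
    (c : chart R n M) (X : M -> 'rV[R]_n) : 'rV[R]_n -> 'rV[R]_n :=
  fun y => tangent_map c (cinv c y) (X (cinv c y)).

Definition smooth_vfield (R : realType) (n : nat) (M : manifold R n)
    (V : set M) (X : M -> 'rV[R]_n) : Prop :=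
  forall q, smooth_on (chart_at q @` (V `&` cdom (chart_at q)))
                      (vf_coord (chart_at q) X).

(* [X, Y] at [p], computed in the chart [chart_at p] by the usual formula
   sum_j (sum_i X^i d_i Y^j - Y^i d_i X^j) d_j. *)
Definition lie_bracket (R : realType) (n : nat) (M : manifold R n)
    (X Y : M -> 'rV[R]_n) : M -> 'rV[R]_n :=
  fun p => 'D_(X p) (vf_coord (chart_at p) Y) (chart_at p p)
         - 'D_(Y p) (vf_coord (chart_at p) X) (chart_at p p).

Definition is_section (R : realType) (n : nat) (M : manifold R n)
    (V : set M) (E : M -> {vspace 'rV[R]_n}) (X : M -> 'rV[R]_n) : Prop :=
  smooth_vfield V X /\ forall p, V p -> X p \in E p.

Definition is_subbundle (R : realType) (n : nat) (M : manifold R n) (k : nat)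
    (E : M -> {vspace 'rV[R]_n}) : Prop :=
  forall a : M, exists V : set M, exists Y : 'I_k -> M -> 'rV[R]_n,
    [/\ open_nbhs a V,
        forall i, is_section V E (Y i) &
        forall p, V p -> basis_of (E p) (mktuple (Y^~ p))].

(* Only the [H w] with 1 <= w <= step are meaningful. *)
Record carnot_manifold (R : realType) (n : nat) := CarnotManifold {
  cmanifold :> manifold R n;
  step : nat;
  H : nat -> cmanifold -> {vspace 'rV[R]_n};
  rk : nat -> nat;
  step_gt0 : (0 < step)%N;
  H_subbundle : forall w, (1 <= w <= step)%N -> is_subbundle (rk w) (H w);
  H_filtration : forall w p, (1 <= w < step)%N -> (H w p <= H w.+1 p)%VS;
  H_step : forall p, H step p = fullv;
  H_bracket : forall w w' (V : set cmanifold) X Y,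
    (1 <= w)%N -> (1 <= w')%N -> (w + w' <= step)%N -> open V ->
    is_section V (H w) X -> is_section V (H w') Y ->
    is_section V (H (w + w')%N) (lie_bracket X Y)
}.

(* Indices in ['I_n] are shifted by one: [j : 'I_n] is the (j+1)-st index.
   The set of [w] is non-empty because rk H_step = n, and it is bounded by
   [step], so that the default value [step] is harmless. *)
Definition weight (R : realType) (n : nat) (M : carnot_manifold R n)
    (j : 'I_n) : nat :=
  \big[minn/step M]_(1 <= w < (step M).+1 | (j.+1 <= rk M w)%N) w.

Definition H_frame (R : realType) (n : nat) (M : carnot_manifold R n)
    (V : set M) (X : 'I_n -> M -> 'rV[R]_n) : Prop :=
  (forall j, is_section V (H (weight M j)) (X j)) /\
  forall p, V p -> basis_of fullv (mktuple (X^~ p)).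

Section Privileged.
Context (R : realType) (n : nat) (M : carnot_manifold R n).
Implicit Types (X : 'I_n -> M -> 'rV[R]_n) (a : M) (x : M -> 'rV[R]_n).

Definition frame_act X (I : seq 'I_n) (f : M -> R^o) : M -> R^o :=
  foldr (fun i g => vf_act (X i) g) f I.

Definition seq_weight (I : seq 'I_n) : nat := (\sum_(i <- I) weight M i)%N.

Definition order_ge X a (f : M -> R^o) (N : nat) : Prop :=
  forall I, (seq_weight I < N)%N -> frame_act X I f a = 0.

Definition has_order X a (f : M -> R^o) (N : nat) : Prop :=
  order_ge X a f N /\ exists2 I, seq_weight I = N & frame_act X I f a != 0.

Definition linearly_adapted X a x : Prop :=
  [/\ local_coords a x, x a = 0 &
      forall j, tangent_map x a (X j a) = delta_mx 0 j].

Definition privileged X a x : Prop :=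
  linearly_adapted X a x /\
  forall k : 'I_n, has_order X a (fun p => x p 0 k) (weight M k).

(* B(a), where X_j = sum_k b_jk d/dx_k in the coordinates [x]. *)
Definition frame_matrix X a x : 'M[R]_n :=
  \matrix_(j, k) tangent_map x a (X j a) 0 k.

(* y |-> (B(a)^t)^-1 (y - a), transposed since points are row vectors; [a] is
   identified with its coordinate vector [x a]. *)
Definition T_map X a x (y : 'rV[R]_n) : 'rV[R]_n :=
  (y - x a) *m invmx (frame_matrix X a x).

(* As all the weights are positive and at most [step], the exponents of a
   multi-index of weight < w_k are at most [step], so that multi-indices can be
   taken in the finite type [{ffun 'I_n -> 'I_(step M).+1}]. *)
Definition mi_length (al : {ffun 'I_n -> 'I_(step M).+1}) : nat :=
  (\sum_i al i)%N.

Definition mi_weight (al : {ffun 'I_n -> 'I_(step M).+1}) : nat :=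
  (\sum_i weight M i * al i)%N.

Definition psi_hat_form (P : 'rV[R]_n -> 'rV[R]_n) : Prop :=
  exists A : 'I_n -> {ffun 'I_n -> 'I_(step M).+1} -> R,
    forall (y : 'rV[R]_n) (k : 'I_n),
      P y 0 k = y 0 k +
        \sum_(al : {ffun 'I_n -> 'I_(step M).+1} |
               (mi_weight al < weight M k)%N && (2 <= mi_length al)%N)
          A k al * \prod_(i < n) y 0 i ^+ al i.

Definition is_psi_hat X a x (P : 'rV[R]_n -> 'rV[R]_n) : Prop :=
  psi_hat_form P /\ privileged X a (P \o T_map X a x \o x).

(* Definite description: the map satisfying [is_psi_hat] if there is exactly
   one such map, and a default value otherwise. *)
Definition psi_hat X a x : 'rV[R]_n -> 'rV[R]_n :=
  get [set P : 'rV[R]_n -> 'rV[R]_n | unique (is_psi_hat X a x) P].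

Definition psi X a x : 'rV[R]_n -> 'rV[R]_n :=
  psi_hat X a x \o T_map X a x.

End Privileged.

(* Main.v *)
(* Only the existence and the uniqueness of the polynomial map in the
   definition of psi_a have to be established.

   Write X_I f(a) for the value at a of a word I in the frame. Exchanging two
   adjacent letters of I changes X_I f(a) by values of words that are shorter and
   of no larger weight: a bracket [X_i, X_j] with w_i + w_j <= r is a smooth
   combination of the X_k with w_k <= w_i + w_j. Hence f has order >= N at a as
   soon as X_I f(a) = 0 for one ordering I of each multi-index of weight < N.

   If y are linearly adapted coordinates, then for |I| <= |alpha| the number
   X_I(y^alpha)(a) is nonzero exactly when I is an ordering of alpha. The
   conditions on the coefficients a_{k alpha} thus form a triangular linear
   system with nonzero diagonal (with respect to the length |alpha|), which has
   exactly one solution.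

   A monomial of weight < w_k only involves coordinates of weight < w_k, so the
   resulting map is triangular and has a polynomial inverse; in particular it is
   a change of coordinates. *)

Require Import Defs.
From HB Require Import structures.
From mathcomp Require Import all_boot all_order all_algebra.
From mathcomp Require Import all_classical all_reals all_analysis.
From mathcomp Require Import ring lra zify.
Set Implicit Arguments.
Unset Strict Implicit.
Unset Printing Implicit Defensive.
Import Order.TTheory GRing.Theory Num.Theory.
Import numFieldNormedType.Exports.
Local Open Scope classical_set_scope.
Local Open Scope ring_scope.

(** * Smooth functions of several variables *)

Lemma is_derive_line (R : realType) n (f : 'rV[R]_n -> R^o) z v (s : R) :
  derivable f (z + s *: v) v ->
  is_derive s 1 (fun t : R => f (z + t *: v) : R^o) ('D_v f (z + s *: v)).
Proof.
move=> df; set g := fun t : R => _.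
have E : (fun h : R => h^-1 *: ((g \o shift s) (h *: 1) - g s)) =
         (fun h : R =>
           h^-1 *: ((f \o shift (z + s *: v)) (h *: v) - f (z + s *: v))).
  apply/funext => h; rewrite /g /=; congr (_ *: (f _ - _)).
  by rewrite scalerDl [h *: 1]mulr1 addrCA.
by split; rewrite /derivable /derive E.
Qed.

(** The one-variable mean value theorem along the line through z in direction v. Bounding c by
    absolute values treats both signs of t at once. *)
Lemma MVT_line (R : realType) n (f : 'rV[R]_n -> R^o) z v (t : R) :
  (forall s : R, `|s| <= `|t| -> derivable f (z + s *: v) v) ->
  exists2 c : R, `|c| <= `|t| & f (z + t *: v) - f z = t * 'D_v f (z + c *: v).
Proof.
move=> df; pose g (s : R) : R^o := f (z + s *: v).
have dg (s : R) : `|s| <= `|t| -> is_derive s 1 g ('D_v f (z + s *: v)).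
  by move=> /df; exact: is_derive_line.
have cg (s : R) : `|s| <= `|t| -> {for s, continuous g}.
  by move=> /dg[+ _] => /derivable1_diffP/differentiable_continuous.
have g0 : g 0 = f z by rewrite /g scale0r addr0.
have [t0|t0] := leP 0 t.
- have [||c] := @MVT_segment _ g (fun s => 'D_v f (z + s *: v)) 0 t t0.
  + move=> s; rewrite in_itv /= => /andP[s0 st]; apply: dg.
    by rewrite (ger0_norm (ltW s0)) (ger0_norm t0) ltW.
  + apply: continuous_in_subspaceT => s; rewrite inE /= in_itv /= => /andP[s0 st].
    by apply: cg; rewrite !ger0_norm.
  rewrite in_itv /= => /andP[c0 ct]; rewrite g0 subr0 => E.
  by exists c; [rewrite !ger0_norm|rewrite E mulrC].
- have [||c] := @MVT_segment _ g (fun s => 'D_v f (z + s *: v)) t 0 (ltW t0).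
  + move=> s; rewrite in_itv /= => /andP[st s0]; apply: dg.
    by rewrite !ltr0_norm // lerN2 ltW.
  + apply: continuous_in_subspaceT => s; rewrite inE /= in_itv /= => /andP[st s0].
    by apply: cg; rewrite !ler0_norm ?(ltW t0) // lerN2.
  rewrite in_itv /= => /andP[ct c0]; rewrite g0 sub0r => E.
  exists c; first by rewrite !ler0_norm ?(ltW t0) // lerN2.
  by rewrite -[LHS]opprB E mulrN opprK mulrC.
Qed.

Lemma rV_normP (R : realType) n (h : 'rV[R]_n) (e : R) : 0 <= e ->
  reflect (forall i, `|h 0 i| <= e) (`|h| <= e).
Proof.
move=> e0; apply: (iffP idP) => [he i|he].
  apply: le_trans he; rewrite /Num.Def.normr/= mx_normrE.
  exact: (le_bigmax _ (fun ij => `|h ij.1 ij.2|) (0, i)).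
rewrite /Num.Def.normr/= mx_normrE; apply: bigmax_le => //= -[i j] _ /=.
by rewrite ord1.
Qed.

Lemma rV_coord_le (R : realType) n (h : 'rV[R]_n) i : `|h 0 i| <= `|h|.
Proof. exact: (rV_normP h (normr_ge0 h) (lexx _)). Qed.

Section PartialToTotal.
Context (R : realType) (n : nat) (f : 'rV[R]_n -> R^o) (y : 'rV[R]_n).

(** The points y + [trunc h k] lead from y to y + h, changing one coordinate at a time. *)
Let trunc (h : 'rV[R]_n) (k : nat) : 'rV[R]_n :=
  \row_i (if (i < k)%N then h 0 i else 0).

Let truncS h (k : 'I_n) : trunc h k.+1 = trunc h k + h 0 k *: delta_mx 0 k.
Proof.
apply/rowP => i; rewrite !mxE /= ltnS leq_eqVlt val_eqE.
have [->|ik] /= := eqVneq i k; first by rewrite ltnn mulr1 add0r.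
by rewrite mulr0 addr0.
Qed.

(** The increment of f telescopes along the path of truncations. Each step is parallel to an axis,
    so by the mean value theorem it is h_k times a partial derivative at a point near y, which
    continuity compares with the one at y. *)
Lemma partial_estimate :
  (\forall z \near y, forall i, derivable f z (delta_mx 0 i)) ->
  (forall i, {for y, continuous ('D_(delta_mx 0 i) f)}) ->
  forall e : R, 0 < e -> \forall h \near (0 : 'rV[R]_n),
    `|f (y + h) - f y - \sum_i h 0 i * 'D_(delta_mx 0 i) f y| <= e * `|h|.
Proof.
move=> df cf e e0.
(* The error e is shared among n steps; dividing by [n.+1] also covers dimension 0. *)
have n1 : 0 < n.+1%:R :> R by rewrite ltr0n.
have : \forall z \near y, forall i, derivable f z (delta_mx 0 i) /\
    `|'D_(delta_mx 0 i) f y - 'D_(delta_mx 0 i) f z| <= e / n.+1%:R.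
  have cf' : \forall z \near y, forall i,
      `|'D_(delta_mx 0 i) f y - 'D_(delta_mx 0 i) f z| <= e / n.+1%:R.
    apply: (@filter_forall _ _ (fun i z => `|'D_(delta_mx 0 i) f y -
      'D_(delta_mx 0 i) f z| <= e / n.+1%:R) (nbhs y)) => i.
    exact: ((cvgrPdist_le _ _).1 (cf i) _ (divr_gt0 e0 n1)).
  move: df cf'; apply: filterS2 => z H1 H2 i; split; [exact: H1|exact: H2].
move=> /nbhs_ballP[d /= d0 dd]; near=> h.
have hd : `|h| < d by near: h; apply/nbhs_ballP; exists d => // x;
  rewrite -ball_normE /= sub0r normrN.
have tr k : `|trunc h k| <= `|h|.
  apply/rV_normP => // i; rewrite mxE; case: ifP => _; last by rewrite normr0.
  exact: rV_coord_le.
have step (k : 'I_n) : `|f (y + trunc h k.+1) - f (y + trunc h k)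
    - h 0 k * 'D_(delta_mx 0 k) f y| <= e / n.+1%:R * `|h|.
  have near_seg (s : R) : `|s| <= `|h 0 k| ->
      ball y d (y + trunc h k + s *: delta_mx 0 k).
    move=> sh; rewrite -ball_normE /= -addrA opprD addNKr normrN.
    apply: le_lt_trans hd; apply/rV_normP => // i; rewrite !mxE /=.
    have [->|ik] := eqVneq i k.
      by rewrite ltnn add0r mulr1 (le_trans sh)// rV_coord_le.
    rewrite mulr0 addr0; case: ifP; rewrite ?normr0// => _; exact: rV_coord_le.
  have [s sh|c ch] := @MVT_line _ _ f (y + trunc h k) (delta_mx 0 k) (h 0 k).
    by have [] := dd _ (near_seg _ sh) k.
  rewrite truncS addrA => ->; rewrite -mulrBr normrM mulrC distrC.
  apply: ler_pM => //; last exact: rV_coord_le.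
  by have [] := dd _ (near_seg _ ch) k.
have tel : f (y + h) - f y =
    \sum_(i < n) (f (y + trunc h i.+1) - f (y + trunc h i)).
  have Hn : trunc h n = h by apply/rowP => i; rewrite mxE ltn_ord.
  have H0 : trunc h 0 = 0 by apply/rowP => i; rewrite !mxE.
  rewrite -[in LHS]Hn -[in f y](addr0 y) -H0.
  by rewrite -(telescope_sumr (fun k => f (y + trunc h k)))// big_mkord.
rewrite tel -sumrB (le_trans (ler_norm_sum _ _ _))//.
apply: le_trans (ler_sum _ (fun k _ => step k)) _.
rewrite sumr_const card_ord -mulrnAl ler_wpM2r//.
by rewrite -mulr_natr -mulrA ler_piMr ?(ltW e0)// mulrC ler_pdivrMr// mul1r ler_nat.
Unshelve. all: by end_near. Qed.

Lemma partial_differentiable :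
  (\forall z \near y, forall i, derivable f z (delta_mx 0 i)) ->
  (forall i, {for y, continuous ('D_(delta_mx 0 i) f)}) ->
  differentiable f y.
Proof.
move=> df cf.
pose d (h : 'rV[R]_n) : R^o := \sum_i h 0 i * 'D_(delta_mx 0 i) f y.
have dlin : linear d.
  move=> a u v; rewrite /d scaler_sumr -big_split /=; apply: eq_bigr => i _.
  by rewrite !mxE mulrDl -mulrA.
pose dM := GRing.isLinear.Build _ _ _ _ _ dlin.
pose dL : {linear 'rV[R]_n -> R^o} := HB.pack d dM.
have dc : continuous dL.
  apply: continuous_big => [|i _ h]; first exact: add_continuous.
  apply: (@cvgM _ _ (nbhs h) _ (fun h : 'rV[R]_n => h 0 i)); last exact: cvg_cst.
  exact: coord_continuous.
pose g : 'rV[R]_n -> R^o := cst (f y) + (dL : 'rV[R]_n -> R^o).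
have E : (f \o shift y : 'rV[R]_n -> R^o) = g +o_ (0 : 'rV[R]_n) id.
  apply/eqaddoP => e e0; have := partial_estimate df cf e0.
  apply: filterS => h.
  rewrite /= !fctE /= [h + y]addrC opprD addrA /=. exact: id.
by apply/diff_locallyP; rewrite (diff_unique dc E).
Qed.

End PartialToTotal.

Lemma growth_rate_shift (R : realType) (V W : normedModType R) (f : V -> W)
    (w z v : V) :
  (fun h : R => h^-1 *: (((fun x => f (x + w)) \o shift z) (h *: v) - f (z + w)))
  = (fun h : R => h^-1 *: ((f \o shift (z + w)) (h *: v) - f (z + w))).
Proof. by apply/funext => h /=; rewrite addrA. Qed.

Lemma derive_shiftE (R : realType) (V W : normedModType R) (f : V -> W)
    (w z v : V) : 'D_v (fun x => f (x + w)) z = 'D_v f (z + w).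
Proof. by rewrite /derive growth_rate_shift. Qed.

Lemma derivable_shift (R : realType) (V W : normedModType R) (f : V -> W)
    (w z v : V) : derivable f (z + w) v -> derivable (fun x => f (x + w)) z v.
Proof. by rewrite /derivable growth_rate_shift. Qed.

Lemma exists_small_scale (R : realType) (d c : R) :
  0 < d -> 0 <= c -> exists2 s : R, 0 < s & `|s| * c < d.
Proof.
move=> d0 c0; have c1 : 0 < c + 1 by rewrite ltr_wpDl.
have s0 := divr_gt0 d0 c1; exists (d / (c + 1)) => //.
by rewrite (gtr0_norm s0) mulrAC ltr_pdivrMr// ltr_pM2l// ltrDl.
Qed.

(** * Symmetry of mixed second derivatives *)

Section Schwarz.
Context (R : realType) (n : nat).
Implicit Types (f : 'rV[R]_n -> R^o) (y u v : 'rV[R]_n).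

(** The mean value theorem is used twice: for the function x |-> f(x + s v) - f(x) in direction u,
    then for the derivative of f along u in direction v. *)
Lemma second_difference f y u v (s d : R) :
  (forall z, ball y d z -> derivable f z u /\ derivable ('D_u f) z v) ->
  `|s| * (`|u| + `|v|) < d ->
  exists2 z, ball y d z &
    f (y + s *: u + s *: v) - f (y + s *: u) - (f (y + s *: v) - f y) =
    s * (s * 'D_v ('D_u f) z).
Proof.
move=> df sd.
have small (c c' : R) : `|c| <= `|s| -> `|c'| <= `|s| ->
    ball y d (y + c *: u + c' *: v).
  move=> cs cs'; rewrite -ball_normE /= -addrA opprD addNKr normrN.
  apply: le_lt_trans sd; rewrite mulrDr (le_trans (ler_normD _ _))//.
  by rewrite !normrZ lerD// ler_wpM2r.
have small0 (c : R) : `|c| <= `|s| -> ball y d (y + c *: u).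
  by move=> cs; rewrite -[y + _]addr0 -(scale0r v); apply: small; rewrite ?normr0.
pose g (x : 'rV[R]_n) : R^o := f (x + s *: v) - f x.
have dg (c : R) : `|c| <= `|s| -> derivable g (y + c *: u) u.
  move=> cs; apply: derivableB; last exact: (df _ (small0 _ cs)).1.
  exact: derivable_shift (df _ (small _ _ cs (lexx _))).1.
have [c cs E] := MVT_line dg.
have [c' cs'|c' cs' E'] := @MVT_line _ _ ('D_u f) (y + c *: u) v s.
  exact: (df _ (small _ _ cs cs')).2.
exists (y + c *: u + c' *: v); first exact: small.
rewrite -E' -[LHS]/(g (y + s *: u) - g y) E; congr (_ * _).
have d1 : derivable (fun x => f (x + s *: v)) (y + c *: u) u.
  exact: derivable_shift (df _ (small _ _ cs (lexx _))).1.
have d2 : derivable f (y + c *: u) u by exact: (df _ (small0 _ cs)).1.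
by rewrite (deriveB d1 d2) derive_shiftE.
Qed.

(** Both mixed derivatives, at two suitable points near y, equal the same second difference divided
    by s^2. If their values at y differed by e > 0, continuity within e/3 would give a
    contradiction. *)
Lemma derive_comm f y u v :
  (\forall z \near y, [/\ derivable f z u, derivable f z v,
     derivable ('D_u f) z v & derivable ('D_v f) z u]) ->
  {for y, continuous ('D_v ('D_u f))} -> {for y, continuous ('D_u ('D_v f))} ->
  'D_v ('D_u f) y = 'D_u ('D_v f) y.
Proof.
move=> df c1 c2; apply/eqP/negPn/negP; rewrite -subr_eq0 -normr_gt0 => ne.
have [e eE] : exists e : R, e = `|'D_v ('D_u f) y - 'D_u ('D_v f) y|.
  by exists (`|'D_v ('D_u f) y - 'D_u ('D_v f) y|).
rewrite -eE in ne; have e0 : 0 < e / 3 by rewrite divr_gt0.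
have : \forall z \near y, [/\ derivable f z u /\ derivable ('D_u f) z v,
    derivable f z v /\ derivable ('D_v f) z u,
    `|'D_v ('D_u f) y - 'D_v ('D_u f) z| < e / 3 &
    `|'D_u ('D_v f) y - 'D_u ('D_v f) z| < e / 3].
  have h1 : \forall z \near y, `|'D_v ('D_u f) y - 'D_v ('D_u f) z| < e / 3.
    exact: ((cvgrPdist_lt _ _).1 c1 _ e0).
  have h2 : \forall z \near y, `|'D_u ('D_v f) y - 'D_u ('D_v f) z| < e / 3.
    exact: ((cvgrPdist_lt _ _).1 c2 _ e0).
  apply: filterS3 df h1 h2 => z [? ? ? ?] ? ?; split => //; split => //.
move=> /nbhs_ballP[d /= d0 dd].
have [s s0 sd] := exists_small_scale d0 (addr_ge0 (normr_ge0 u) (normr_ge0 v)).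
have duv z : ball y d z -> derivable f z u /\ derivable ('D_u f) z v.
  by case/dd => H _ _ _; exact: H.
have dvu z : ball y d z -> derivable f z v /\ derivable ('D_v f) z u.
  by case/dd => _ H _ _; exact: H.
have [z1 b1 E1] := second_difference duv sd.
rewrite addrC in sd; have [z2 b2 E2] := second_difference dvu sd.
(* The second difference is symmetric in u and v, which allows [E1] and [E2] to be compared. *)
have swap (a b c d' : R^o) : a - b - (c - d') = a - c - (b - d').
  by rewrite !opprB addrACA [RHS]addrACA; congr (_ + _); rewrite addrC.
rewrite (addrAC y) in E2; move: (etrans (etrans (esym E1) (swap _ _ _ _)) E2).
do 2 move=> /(mulfI (lt0r_neq0 s0)).
have [_ _ h1 _] := dd _ b1; have [_ _ _ h2] := dd _ b2.
have tri (p q c : R^o) : `|p - c| < e / 3 -> `|q - c| < e / 3 ->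
    `|p - q| < e / 3 + e / 3.
  move=> hp hq; apply: le_lt_trans (ler_distD c p q) _.
  by rewrite ltrD// distrC.
move=> E3; rewrite E3 in h1; have := tri _ _ _ h1 h2; rewrite -eE.
by move: ne; clear; lra.
Qed.

End Schwarz.

(** * Stability properties of C^k functions *)

Section CkBasics.
Context (R : realType) (n : nat).
Implicit Types (W : normedModType R) (U : set 'rV[R]_n) (y : 'rV[R]_n).

Lemma Ck_continuous W k U (f : 'rV[R]_n -> W) y :
  Ck k U f -> U y -> {for y, continuous f}.
Proof. by case: k => [|k] [+ _] => /[apply]. Qed.

Lemma Ck_derivable W k U (f : 'rV[R]_n -> W) i :
  Ck k.+1 U f -> forall y, U y -> derivable f y (delta_mx 0 i).
Proof. move=> [_ /(_ i)[df _]]; exact: df. Qed.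

Lemma Ck_partial W k U (f : 'rV[R]_n -> W) i :
  Ck k.+1 U f -> Ck k U ('D_(delta_mx 0 i) f).
Proof. move=> [_ /(_ i)[_ cf]]; exact: cf. Qed.

Lemma CkW W k U (f : 'rV[R]_n -> W) : Ck k.+1 U f -> Ck k U f.
Proof.
elim: k f => [|k IH] f; first by case.
move=> [cf df]; split=> // i; have [dfi cfi] := df i.
split; [exact: dfi|exact: IH cfi].
Qed.

Lemma Ck_sub W k U U' (f : 'rV[R]_n -> W) : U' `<=` U -> Ck k U f -> Ck k U' f.
Proof.
move=> UU'; elim: k f => [|k IH] f [cf df]; split=> //.
- move=> y /UU'; exact: cf.
- move=> y /UU'; exact: cf.
- move=> i; have [dfi cfi] := df i.
  split; [move=> y /UU'; exact: dfi|exact: IH cfi].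
Qed.

Lemma near_open_eq W U (f g : 'rV[R]_n -> W) y : open U ->
  (forall z, U z -> f z = g z) -> U y -> \forall z \near y, f z = g z.
Proof.
by move=> oU fg Uy; apply: filterS (open_nbhs_nbhs (conj oU Uy)) => z /fg.
Qed.

Lemma near_eq_continuous W (f g : 'rV[R]_n -> W) y :
  (\forall z \near y, f z = g z) ->
  {for y, continuous f} -> {for y, continuous g}.
Proof.
move=> fg; have fgy : f y = g y := nbhs_singleton fg.
rewrite /prop_for /continuous_at /= -fgy.
move=> cf; apply: cvg_trans cf; exact: near_eq_cvg fg.
Qed.

(** Openness makes f and g agree near every point of U, so their partial derivatives agree on U and
    the induction on k proceeds. *)
Lemma Ck_ext W k U (f g : 'rV[R]_n -> W) : open U ->
  (forall y, U y -> f y = g y) -> Ck k U f -> Ck k U g.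
Proof.
move=> oU; elim: k f g => [|k IH] f g fg [cf df].
  split=> // y Uy; have fgy := near_open_eq oU fg Uy.
  exact: near_eq_continuous fgy (cf _ Uy).
split=> [y Uy|i].
  have fgy := near_open_eq oU fg Uy.
  exact: near_eq_continuous fgy (cf _ Uy).
have [dfi cfi] := df i; split.
  move=> y Uy; exact: near_eq_derivable (near_open_eq oU fg Uy) (dfi _ Uy).
apply: IH cfi => y Uy; exact: near_eq_derive (near_open_eq oU fg Uy).
Qed.

Lemma Ck_cst W k U (c : W) : Ck k U (fun=> c).
Proof.
elim: k c => [|k IH] c; (split; [by move=> y _; exact: cst_continuous|]) => // i.
split=> [y _|]; first exact: derivable_cst.
have -> : 'D_(delta_mx 0 i) (fun _ : 'rV[R]_n => c) = fun=> 0.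
  by apply/funext => y; exact: derive_cst.
exact: IH.
Qed.

Lemma CkD W k U (f g : 'rV[R]_n -> W) : open U ->
  Ck k U f -> Ck k U g -> Ck k U (fun y => f y + g y).
Proof.
move=> oU; elim: k f g => [|k IH] f g cf cg.
  split=> // y Uy; apply: continuousD; first exact: Ck_continuous cf Uy.
  exact: Ck_continuous cg Uy.
split=> [y Uy|i].
  apply: continuousD; first exact: Ck_continuous cf Uy.
  exact: Ck_continuous cg Uy.
have df := @Ck_derivable _ _ _ _ i cf; have dg := @Ck_derivable _ _ _ _ i cg.
split=> [y Uy|].
  exact: derivableD (df _ Uy) (dg _ Uy).
have := IH _ _ (@Ck_partial _ _ _ _ i cf) (@Ck_partial _ _ _ _ i cg).
apply: Ck_ext => // y Uy.
exact: esym (deriveD (df _ Uy) (dg _ Uy)).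
Qed.

Lemma Ck_sum W k U (I : Type) (r : seq I) (P : pred I) (F : I -> 'rV[R]_n -> W) :
  open U -> (forall i, P i -> Ck k U (F i)) ->
  Ck k U (fun y => \sum_(i <- r | P i) F i y).
Proof.
move=> oU cF; elim: r => [|i r IH].
  apply: Ck_ext (Ck_cst k U (0 : W)) => // y _; by rewrite big_nil.
have [Pi|Pi] := boolP (P i).
  apply: Ck_ext (CkD oU (cF i Pi) IH) => // y _; by rewrite big_cons Pi.
by apply: Ck_ext IH => // y _; rewrite big_cons (negbTE Pi).
Qed.

Lemma CkM k U (f g : 'rV[R]_n -> R^o) : open U ->
  Ck k U f -> Ck k U g -> Ck k U (fun y => f y * g y : R^o).
Proof.
move=> oU; elim: k f g => [|k IH] f g cf cg.
  split=> // y Uy; apply: continuousM; first exact: Ck_continuous cf Uy.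
  exact: Ck_continuous cg Uy.
split=> [y Uy|i].
  apply: continuousM; first exact: Ck_continuous cf Uy.
  exact: Ck_continuous cg Uy.
have df := @Ck_derivable _ _ _ _ i cf; have dg := @Ck_derivable _ _ _ _ i cg.
split=> [y Uy|].
  exact: derivableM (df _ Uy) (dg _ Uy).
have := CkD oU (IH _ _ (CkW cf) (@Ck_partial _ _ _ _ i cg))
               (IH _ _ (CkW cg) (@Ck_partial _ _ _ _ i cf)).
apply: Ck_ext => // y Uy.
exact: esym (deriveM (df _ Uy) (dg _ Uy)).
Qed.

Lemma CkZ k U (c : R) (f : 'rV[R]_n -> R^o) : open U ->
  Ck k U f -> Ck k U (fun y => c * f y : R^o).
Proof. by move=> oU; apply: CkM => //; exact: Ck_cst. Qed.

Lemma Ck_prod k U (I : Type) (r : seq I) (P : pred I)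
    (F : I -> 'rV[R]_n -> R^o) :
  open U -> (forall i, P i -> Ck k U (F i)) ->
  Ck k U (fun y => \prod_(i <- r | P i) F i y : R^o).
Proof.
move=> oU cF; elim: r => [|i r IH].
  apply: Ck_ext (Ck_cst k U (1 : R^o)) => // y _; by rewrite big_nil.
have [Pi|Pi] := boolP (P i).
  apply: Ck_ext (CkM oU (cF i Pi) IH) => // y _; by rewrite big_cons Pi.
by apply: Ck_ext IH => // y _; rewrite big_cons (negbTE Pi).
Qed.

Lemma CkX k U m (f : 'rV[R]_n -> R^o) : open U ->
  Ck k U f -> Ck k U (fun y => f y ^+ m : R^o).
Proof.
move=> oU cf; have := @Ck_prod k U _ (index_enum 'I_m) xpredT (fun=> f) oU.
move=> /(_ (fun _ _ => cf)); apply: Ck_ext => // y _.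
by rewrite prodr_const card_ord.
Qed.

(** The derivative of 1/f is -f'/f^2, in which 1/f occurs only with the regularity given by the
    induction hypothesis. *)
Lemma CkV k U (f : 'rV[R]_n -> R^o) : open U ->
  (forall y, U y -> f y != 0) -> Ck k U f -> Ck k U (fun y => (f y)^-1 : R^o).
Proof.
move=> oU f0; elim: k => [|k IH] cf.
  by split=> // y Uy; apply: continuousV; [exact: f0|exact: Ck_continuous cf Uy].
split=> [y Uy|i].
  by apply: continuousV; [exact: f0|exact: Ck_continuous cf Uy].
have df := @Ck_derivable _ _ _ _ i cf.
split=> [y Uy|]; first exact: derivableV (f0 _ Uy) (df _ Uy).
have cV := IH (CkW cf).
have := CkM oU (CkZ (-1) oU (CkX 2 oU cV)) (@Ck_partial _ _ _ _ i cf).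
apply: Ck_ext => // y Uy; rewrite mulN1r exprVn.
exact: esym (deriveV (f0 _ Uy) (df _ Uy)).
Qed.

Lemma continuous_rVP m (f : 'rV[R]_n -> 'rV[R]_m) y :
  (forall j, {for y, continuous (fun z => f z 0 j : R^o)}) ->
  {for y, continuous f}.
Proof.
move=> cf; apply/(@cvgrPdist_le R 'rV[R]_m _ (nbhs (y : 'rV[R]_n))) => e e0.
have : \forall z \near y, forall j, `|f y 0 j - f z 0 j| <= e.
  apply: (@filter_forall _ _ (fun j z => `|f y 0 j - f z 0 j| <= e) (nbhs y)).
  move=> j; exact: ((cvgrPdist_le _ _).1 (cf j) _ e0).
apply: filterS => z ze; apply/rV_normP; first exact: ltW.
by move=> j; rewrite !mxE.
Qed.

Lemma derivable_rVP m (f : 'rV[R]_n -> 'rV[R]_m) y v :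
  derivable f y v <-> forall j, derivable (fun z => f z 0 j : R^o) y v.
Proof.
split=> [/derivable_mxP df j|df]; first exact: df.
by apply/derivable_mxP => i j; rewrite ord1; exact: df.
Qed.

Lemma derive_rVE m (f : 'rV[R]_n -> 'rV[R]_m) y v j : derivable f y v ->
  'D_v f y 0 j = 'D_v (fun z => f z 0 j : R^o) y.
Proof. by move=> df; rewrite derive_mx// mxE. Qed.

Lemma Ck_rVP m k U (f : 'rV[R]_n -> 'rV[R]_m) : open U ->
  Ck k U f <-> forall j, Ck k U (fun z => f z 0 j : R^o).
Proof.
move=> oU; split.
- move=> cf j; elim: k f cf => [|k IH] f cf.
    split=> // y Uy; apply: (@continuous_comp _ _ _ f (fun z : 'rV[R]_m => z 0 j)).
      exact: Ck_continuous cf Uy.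
    exact: coord_continuous.
  split=> [y Uy|i].
    apply: (@continuous_comp _ _ _ f (fun z : 'rV[R]_m => z 0 j)).
      exact: Ck_continuous cf Uy.
    exact: coord_continuous.
  have df := @Ck_derivable _ _ _ _ i cf; split=> [y Uy|].
    exact: (derivable_rVP _ _ _).1 (df _ Uy) j.
  apply: Ck_ext (IH _ (@Ck_partial _ _ _ _ i cf)) => // y Uy.
  exact: derive_rVE (df _ Uy).
- elim: k f => [|k IH] f cf.
    split=> // y Uy; apply: continuous_rVP => j; exact: (Ck_continuous (cf j) Uy).
  split=> [y Uy|i].
    apply: continuous_rVP => j; exact: (Ck_continuous (cf j) Uy).
  have df y : U y -> derivable f y (delta_mx 0 i).
    move=> Uy; apply/derivable_rVP => j; exact: (Ck_derivable (cf j) Uy).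
  split=> [y Uy|]; first exact: df.
  apply: IH => j; apply: Ck_ext (@Ck_partial _ _ _ _ i (cf j)) => // y Uy.
  exact: esym (derive_rVE _ (df _ Uy)).
Qed.

Lemma Ck_coord k U i : Ck k U (fun y => y 0 i : R^o).
Proof.
have dc y v : derivable (fun y : 'rV[R]_n => y 0 i : R^o) y v.
  exact: diff_derivable (differentiable_coord _ _ _).
have D v : 'D_v (fun y : 'rV[R]_n => y 0 i : R^o) = fun=> v 0 i.
  apply/funext => y; have di : derivable (@id 'rV[R]_n) y v := @derivable_id _ _ y v.
  by rewrite -(derive_rVE i di) derive_id.
case: k => [|k]; (split; [by move=> y _; exact: coord_continuous|]) => // j.
split=> [y _|]; first exact: dc.
by rewrite D; exact: Ck_cst.
Qed.

Lemma Ck_id k U : open U -> Ck k U (@id 'rV[R]_n).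
Proof. by move=> oU; apply/Ck_rVP => // j; exact: Ck_coord. Qed.

End CkBasics.

Arguments Ck_derivable {R n W k U f} i _ {y}.
Arguments Ck_partial {R n W k U f} i.

(** * Chain rule, composition and matrix inversion *)

Section Chain.
Context (R : realType).

Lemma Ck_differentiable n k (U : set 'rV[R]_n) (f : 'rV[R]_n -> R^o)
    (y : 'rV[R]_n) :
  open U -> Ck k.+1 U f -> U y -> differentiable f y.
Proof.
move=> oU cf Uy; apply: partial_differentiable.
- apply: filterS (open_nbhs_nbhs (conj oU Uy)) => z Uz i.
  exact: (Ck_derivable i cf Uz).
- move=> i; exact: (Ck_continuous (Ck_partial i cf) Uy).
Qed.

Lemma differentiable_rVP n m (f : 'rV[R]_n -> 'rV[R]_m) y :
  (forall j, differentiable (fun z => f z 0 j : R^o) y) -> differentiable f y.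
Proof.
move=> df.
have -> : f = \sum_(j < m) (fun z => f z 0 j *: (delta_mx 0 j : 'rV[R]_m)).
  by apply/funext => z; rewrite fct_sumE; exact: row_sum_delta.
apply: differentiable_sum => j; exact: differentiableZl (df j).
Qed.

Lemma Ck_differentiable_rV n m k (U : set 'rV[R]_n) (f : 'rV[R]_n -> 'rV[R]_m)
    (y : 'rV[R]_n) : open U -> Ck k.+1 U f -> U y -> differentiable f y.
Proof.
move=> oU cf Uy; apply: differentiable_rVP => j.
exact: Ck_differentiable oU ((Ck_rVP _ _ oU).1 cf j) Uy.
Qed.

Lemma derive_comp (V W Z : normedModType R) (F : W -> Z) (G : V -> W) y v :
  differentiable G y -> differentiable F (G y) ->
  'D_v (F \o G) y = 'D_('D_v G y) F (G y).
Proof.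
move=> dG dF; have dFG := differentiable_comp dG dF.
by rewrite (deriveE _ dFG) (deriveE _ dG) (deriveE _ dF) diff_comp.
Qed.

Lemma derive_sum_coord n (W : normedModType R) (F : 'rV[R]_n -> W) y v :
  differentiable F y -> 'D_v F y = \sum_i v 0 i *: 'D_(delta_mx 0 i) F y.
Proof.
move=> dF; rewrite (deriveE _ dF) [in LHS](row_sum_delta v) linear_sum.
by apply: eq_bigr => i _; rewrite linearZ (deriveE _ dF).
Qed.

(** By the chain rule, a partial derivative of F o G is a sum of products of partial derivatives of
    G with partial derivatives of F composed with G; the latter are C^k by induction. *)
Lemma Ck_comp_scalar n m k (U : set 'rV[R]_n) (U' : set 'rV[R]_m)
    (F : 'rV[R]_m -> R^o) (G : 'rV[R]_n -> 'rV[R]_m) :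
  open U -> open U' -> (forall y, U y -> U' (G y)) ->
  Ck k U' F -> Ck k U G -> Ck k U (F \o G).
Proof.
move=> oU oU' UG; elim: k F => [|k IH] F cF cG.
  split=> // y Uy; apply: continuous_comp; first exact: (Ck_continuous cG Uy).
  exact: (Ck_continuous cF (UG _ Uy)).
split=> [y Uy|i].
  apply: continuous_comp; first exact: (Ck_continuous cG Uy).
  exact: (Ck_continuous cF (UG _ Uy)).
have dG y : U y -> differentiable G y by exact: Ck_differentiable_rV oU cG.
have dF y : U y -> differentiable F (G y).
  by move/UG; exact: Ck_differentiable oU' cF.
split=> [y Uy|].
  exact: diff_derivable (differentiable_comp (dG _ Uy) (dF _ Uy)).
have cS : Ck k U (fun y => \sum_(j < m) 'D_(delta_mx 0 i) G y 0 j *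
    ('D_(delta_mx 0 j) F \o G) y : R^o).
  apply: Ck_sum => // j _; apply: CkM => //.
    exact: ((Ck_rVP _ _ oU).1 (Ck_partial i cG) j).
  exact: IH (Ck_partial j cF) (CkW cG).
apply: Ck_ext cS => // y Uy.
by rewrite (derive_comp _ (dG _ Uy) (dF _ Uy)) (derive_sum_coord _ (dF _ Uy)).
Qed.

Lemma Ck_comp n m p k (U : set 'rV[R]_n) (U' : set 'rV[R]_m)
    (F : 'rV[R]_m -> 'rV[R]_p) (G : 'rV[R]_n -> 'rV[R]_m) :
  open U -> open U' -> (forall y, U y -> U' (G y)) ->
  Ck k U' F -> Ck k U G -> Ck k U (F \o G).
Proof.
move=> oU oU' UG cF cG; apply/Ck_rVP => // j.
exact: Ck_comp_scalar oU oU' UG ((Ck_rVP _ _ oU').1 cF j) cG.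
Qed.

Lemma smooth_derive n (U : set 'rV[R]_n) (f : 'rV[R]_n -> R^o)
    (xi : 'rV[R]_n -> 'rV[R]_n) : open U -> smooth_on U f -> smooth_on U xi ->
  smooth_on U (fun y => 'D_(xi y) f y).
Proof.
move=> oU cf cxi k.
have cS : Ck k U (fun y => \sum_(j < n) xi y 0 j * 'D_(delta_mx 0 j) f y : R^o).
  apply: Ck_sum => // j _; apply: CkM => //.
    exact: ((Ck_rVP _ _ oU).1 (cxi k) j).
  exact: Ck_partial j (cf k.+1).
apply: Ck_ext cS => // y Uy.
exact: esym (derive_sum_coord _ (Ck_differentiable oU (cf 1%N) Uy)).
Qed.

Lemma Ck_det n m k (U : set 'rV[R]_n) (A : 'rV[R]_n -> 'M[R]_m) : open U ->
  (forall i j, Ck k U (fun y => A y i j : R^o)) ->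
  Ck k U (fun y => \det (A y) : R^o).
Proof.
move=> oU cA; apply: Ck_sum => // s _; apply: CkZ => //.
by apply: Ck_prod => // i _; exact: cA.
Qed.

(** Cramer's rule: the entries of the inverse are cofactors divided by the determinant. *)
Lemma Ck_invmx n m k (U : set 'rV[R]_n) (A : 'rV[R]_n -> 'M[R]_m) i j : open U ->
  (forall y, U y -> A y \in unitmx) ->
  (forall i j, Ck k U (fun y => A y i j : R^o)) ->
  Ck k U (fun y => invmx (A y) i j : R^o).
Proof.
move=> oU uA cA.
have cadj : Ck k U (fun y => \adj (A y) i j : R^o).
  apply: (@Ck_ext _ _ _ _ _ (fun y => cofactor (A y) j i)) => // [y _|].
    by rewrite mxE.
  apply: CkZ => //; apply: Ck_det => // i' j'.
  by apply: Ck_ext (cA (lift j i') (lift i j')) => // y _; rewrite !mxE.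
have uA0 y : U y -> \det (A y) != 0.
  by move/uA; rewrite unitmxE unitfE.
apply: Ck_ext (CkM oU (CkV oU uA0 (Ck_det oU cA)) cadj) => // y Uy.
by rewrite /invmx uA// !mxE.
Qed.

End Chain.

(** * Words of derivations and their values at a point *)

(** Adjacent transpositions generate all permutations. The predicate [Q] confines the swaps to the
    sequences for which they are known to be harmless; it will fix the length of a word and bound
    its weight. *)
Lemma perm_swap_invariant (T : eqType) (A : Type) (Q : seq T -> Prop)
    (phi : seq T -> A) :
  (forall s t, perm_eq s t -> Q s -> Q t) ->
  (forall s1 x y s2, Q (s1 ++ x :: y :: s2) ->
     phi (s1 ++ x :: y :: s2) = phi (s1 ++ y :: x :: s2)) ->
  forall s t, perm_eq s t -> Q s -> phi s = phi t.
Proof.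
move=> Qp sw.
have move_in t1 : forall s1 x t2, Q (s1 ++ x :: t1 ++ t2) ->
    phi (s1 ++ x :: t1 ++ t2) = phi (s1 ++ t1 ++ x :: t2).
  elim: t1 => [//|z t1 IH] s1 x t2 Qs; rewrite /= sw//.
  have := IH (rcons s1 z) x t2; rewrite !cat_rcons; apply.
  by apply: Qp Qs; rewrite perm_cat2l (perm_catCA [:: x] [:: z]).
(* The prefix s0 collects the letters already in place. *)
suff gen s : forall s0 t, perm_eq s t -> Q (s0 ++ s) ->
    phi (s0 ++ s) = phi (s0 ++ t).
  by move=> s t; exact: gen s [::] t.
elim: s => [|x s IH] s0 t; first by rewrite perm_sym => /perm_nilP ->.
move=> st; have xt : x \in t by rewrite -(perm_mem st) mem_head.
case/splitPr: xt st => t1 t2.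
rewrite -[x :: t2]cat1s perm_sym (perm_catCA t1 [:: x] t2) perm_cons perm_sym.
move=> st Qs; rewrite -cat_rcons (IH _ _ st) cat_rcons// move_in//.
by apply: Qp Qs; rewrite perm_cat2l perm_cons.
Qed.

(** * Linear systems that are triangular with respect to a level function *)

Section TriangularSystem.
Context (R : fieldType) (T : finType) (P : pred T) (l : T -> nat)
  (m : T -> T -> R).
Hypothesis m_tri : forall x y, P x -> P y -> (l x <= l y)%N ->
  (m x y != 0) = (x == y).

Let m_eq0 x y : P x -> P y -> (l x <= l y)%N -> x != y -> m x y = 0.
Proof. by move=> Px Py xy; rewrite -(m_tri Px Py xy) negbK => /eqP. Qed.

(** The equations are solved by increasing level. Adding the residue divided by the diagonal entry
    changes A on level L only; such an unknown occurs in no equation of lower level, and on level L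
    only in its own equation. *)
Lemma triangular_solvable (b : T -> R) :
  exists A : T -> R, forall x, P x -> \sum_(y | P y) m x y * A y = b x.
Proof.
suff [A HA] : exists A : T -> R, forall x, P x ->
    (l x < (\max_x l x).+1)%N -> \sum_(y | P y) m x y * A y = b x.
  by exists A => x Px; apply: HA => //; rewrite ltnS leq_bigmax.
move: (_.+1) => L; elim: L => [|L [A HA]]; first by exists (fun=> 0).
pose d x := (b x - \sum_(y | P y) m x y * A y) / m x x.
pose A' x := A x + (if l x == L then d x else 0).
exists A' => x Px; rewrite ltnS leq_eqVlt => lxL.
under eq_bigr do rewrite mulrDr; rewrite big_split /=.
rewrite [X in _ + X](bigD1 x)//= [X in _ + (_ + X)]big1 => [|y /andP[Py yx]];
  last first.
  case: eqVneq => [lyL|_]; last by rewrite mulr0.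
  rewrite (m_eq0 Px Py) ?mul0r// 1?eq_sym// lyL.
  by case/orP: lxL => [/eqP->|/ltnW].
rewrite addr0; case: eqVneq lxL => /= [_ _|_ lxL]; last by rewrite mulr0 addr0 HA.
by rewrite /d mulrCA divff ?mulr1 ?subrKC// m_tri.
Qed.

(** By induction on the level: in equation x the unknowns of lower level already agree and all
    others except x have coefficient zero, so the diagonal term alone remains. *)
Lemma triangular_unique (A A' : T -> R) :
  (forall x, P x -> \sum_(y | P y) m x y * A y = \sum_(y | P y) m x y * A' y) ->
  forall x, P x -> A x = A' x.
Proof.
move=> E x; have [L] := ubnP (l x); elim: L x => // L IH x; rewrite ltnS => lxL Px.
have : \sum_(y | P y) m x y * (A y - A' y) = 0.
  by under eq_bigr do rewrite mulrBr; rewrite sumrB E// subrr.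
rewrite (bigD1 x)//= big1 => [|y /andP[Py yx]].
  move/eqP; rewrite addr0 mulf_eq0 => /orP[|]; last by rewrite subr_eq0 => /eqP.
  by rewrite -[_ == 0]negbK m_tri// eqxx.
have [xy|yx'] := leqP (l x) (l y); first by rewrite (m_eq0 Px Py) ?mul0r// eq_sym.
by rewrite IH ?subrr ?mulr0// (leq_trans yx').
Qed.

End TriangularSystem.

Definition word_act (n : nat) (T : Type) (R : Type)
    (D : 'I_n -> (T -> R) -> T -> R) (s : seq 'I_n) (f : T -> R) : T -> R :=
  foldr (fun i g => D i g) f s.

(* [S] plays the role of the smooth functions on an open set [V], and the
   [D i] that of vector fields acting as derivations. *)
Record derivations (R : realFieldType) (T : Type) (n : nat) (V : T -> Prop)
    (S : (T -> R) -> Prop) (D : 'I_n -> (T -> R) -> T -> R) : Prop := {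
  S_cst : forall c, S (fun=> c);
  S_add : forall f g, S f -> S g -> S (fun p => f p + g p);
  S_mul : forall f g, S f -> S g -> S (fun p => f p * g p);
  S_der : forall i f, S f -> S (D i f);
  der_ext : forall i f g p,
    (forall q, V q -> f q = g q) -> V p -> D i f p = D i g p;
  der_cst : forall i c p, V p -> D i (fun=> c) p = 0;
  der_add : forall i f g p, S f -> S g -> V p ->
    D i (fun q => f q + g q) p = D i f p + D i g p;
  der_mul : forall i f g p, S f -> S g -> V p ->
    D i (fun q => f q * g q) p = f p * D i g p + D i f p * g p }.

Section Words.
Context (R : realFieldType) (T : Type) (n : nat) (V : T -> Prop)
  (S : (T -> R) -> Prop) (D : 'I_n -> (T -> R) -> T -> R).
Hypothesis DS : derivations V S D.
Local Notation act := (word_act D).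
Implicit Types (f g : T -> R) (s t : seq 'I_n).

Lemma S_scale c f : S f -> S (fun p => c * f p).
Proof. by move=> Sf; exact: (S_mul DS (S_cst DS c) Sf). Qed.

Lemma S_sum (I : Type) (r : seq I) (P : pred I) (F : I -> T -> R) :
  (forall k, P k -> S (F k)) -> S (fun p => \sum_(k <- r | P k) F k p).
Proof.
move=> SF; elim: r => [|k r IH].
  by under eq_fun do rewrite big_nil; exact: (S_cst DS 0).
under eq_fun do rewrite big_cons; case: (boolP (P k)) => // Pk.
exact: (S_add DS (SF _ Pk) IH).
Qed.

Lemma act_cat s t f : act (s ++ t) f = act s (act t f).
Proof. exact: foldr_cat. Qed.

Lemma act_rcons s i f : act (rcons s i) f = act s (D i f).
Proof. by rewrite -cats1 act_cat. Qed.

Lemma act_S s f : S f -> S (act s f).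
Proof. by elim: s => //= i s IH Sf; exact: (S_der DS i (IH Sf)). Qed.

Lemma act_ext s f g p : (forall q, V q -> f q = g q) -> V p ->
  act s f p = act s g p.
Proof.
move=> fg; elim: s p => [|i s IH] p Vp /=; first exact: fg.
exact: (der_ext DS i IH Vp).
Qed.

Lemma act0 s p : V p -> act s (fun=> 0) p = 0.
Proof.
elim: s p => //= i s IH p Vp.
by rewrite (der_ext DS i (g := fun=> 0) IH Vp) (der_cst DS).
Qed.

Lemma act_add s f g p : S f -> S g -> V p ->
  act s (fun q => f q + g q) p = act s f p + act s g p.
Proof.
move=> Sf Sg; elim: s p => //= i s IH p Vp.
by rewrite (der_ext DS i IH Vp) (der_add DS)//; exact: act_S.
Qed.

Lemma act_scale s c f p : S f -> V p -> act s (fun q => c * f q) p = c * act s f p.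
Proof.
move=> Sf; elim: s p => //= i s IH p Vp.
rewrite (der_ext DS i IH Vp) (der_mul DS)//; last exact: act_S.
  by rewrite (der_cst DS)// mul0r addr0.
exact: (S_cst DS c).
Qed.

Lemma act_sum s (I : Type) (r : seq I) (P : pred I) (F : I -> T -> R) p :
  (forall k, P k -> S (F k)) -> V p ->
  act s (fun q => \sum_(k <- r | P k) F k q) p =
  \sum_(k <- r | P k) act s (F k) p.
Proof.
move=> SF Vp; elim: r => [|k r IH].
  by rewrite big_nil; under eq_fun do rewrite big_nil; exact: act0.
rewrite big_cons; under eq_fun do rewrite big_cons.
by case: (boolP (P k)) => // Pk; rewrite act_add ?IH//; [exact: SF|exact: S_sum].
Qed.

Lemma act_mul_rcons s i f g p : S f -> S g -> V p ->
  act (rcons s i) (fun q => f q * g q) p =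
  act s (fun q => f q * D i g q) p + act s (fun q => D i f q * g q) p.
Proof.
move=> Sf Sg Vp; rewrite act_rcons -act_add//.
- by apply: act_ext => // q Vq; exact: (der_mul DS i Sf Sg Vq).
- exact: (S_mul DS Sf (S_der DS i Sg)).
- exact: (S_mul DS (S_der DS i Sf) Sg).
Qed.

(** By the product rule every letter falls on f or on g, and the letters falling on g form a
    subsequence of s. The induction peels off the innermost letter, hence the general f and g. *)
Lemma act_mul_eq0 s f g a : S f -> S g -> V a ->
  (forall t, subseq t s -> act t g a = 0) -> act s (fun q => f q * g q) a = 0.
Proof.
move=> Sf Sg Va; elim/last_ind: s f g Sf Sg => [|s i IH] f g Sf Sg g0.
  by have /= -> := g0 [::] isT; rewrite mulr0.
rewrite act_mul_rcons// !IH ?addr0//.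
- exact: (S_der DS i Sf).
- by move=> t ts; apply: g0; apply: subseq_trans ts (subseq_rcons _ _).
- exact: (S_der DS i Sg).
move=> t ts; rewrite -act_rcons; apply: g0.
by rewrite -!cats1 cat_subseq.
Qed.

(** All that the algebraic part retains of the filtration: the commutator of two frame fields is a
    smooth combination of fields of weight at most the sum of the two weights. *)
Definition structure_functions (w : 'I_n -> nat) i j : Prop :=
  exists c : 'I_n -> T -> R,
  [/\ forall k, S (c k),
      forall k p, V p -> (w i + w j < w k)%N -> c k p = 0 &
      forall f p, S f -> V p ->
        D i (D j f) p = D j (D i f) p + \sum_k c k p * D k f p].

Section Weights.
Context (w : 'I_n -> nat) (a : T) (N : nat).
Hypothesis Va : V a.
Local Notation wt s := (\sum_(i <- s) w i)%N.

Lemma wt_subseq s t : subseq s t -> (wt s <= wt t)%N.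
Proof.
elim: t s => [|j t IH] s; first by rewrite subseq0 => /eqP->.
case: s => [|i s] /=; first by rewrite big_nil.
rewrite !big_cons; case: eqP => [->|_] st; first by rewrite leq_add2l IH.
by have := IH _ st; rewrite big_cons => /leq_trans; apply; rewrite leq_addl.
Qed.

Hypothesis brackets : forall i j, (w i + w j < N)%N ->
  structure_functions w i j.

(* The commutator term is a sum of words shorter than the given one and of no
   larger weight, which vanish at [a] by assumption. *)
Lemma act_swap f s1 i j s2 : S f -> (wt (s1 ++ i :: j :: s2) < N)%N ->
  (forall t, (size t < size (s1 ++ i :: j :: s2))%N -> (wt t < N)%N ->
    act t f a = 0) ->
  act (s1 ++ i :: j :: s2) f a = act (s1 ++ j :: i :: s2) f a.
Proof.
rewrite size_cat /= !big_cat !big_cons /= => Sf wN small.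
have [|c [Sc c0 Ec]] := brackets (i := i) (j := j).
  by apply: leq_ltn_trans wN; rewrite [X in (_ <= X)%N]addnA; lia.
set g := act s2 f; have Sg : S g by exact: act_S.
rewrite !act_cat /= -/g.
have Scg k : S (fun p => c k p * D k g p).
  exact: (S_mul DS (Sc k) (S_der DS k Sg)).
have Ssum : S (fun p => \sum_k c k p * D k g p) by apply: S_sum => k _.
rewrite (act_ext s1 (fun p => Ec g p Sg) Va) act_add//; last first.
  exact: (S_der DS _ (S_der DS _ Sg)).
rewrite act_sum// big1 ?addr0// => k _.
have [wk|wk] := ltnP (w i + w j) (w k).
  rewrite (act_ext (g := fun=> 0) s1 _ Va) ?act0// => q Vq.
  by rewrite c0// mul0r.
apply: act_mul_eq0 => //; first exact: (S_der DS k Sg).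
move=> t ts; rewrite -act_rcons -act_cat; apply: small.
  rewrite size_cat size_rcons addSn !addnS !ltnS leq_add2r.
  exact: size_subseq ts.
rewrite big_cat -cats1 big_cat big_seq1 /=; apply: leq_ltn_trans wN.
by rewrite -addnA leq_add ?wt_subseq// addnA leq_add2r.
Qed.

(** By induction on the length: once all shorter words of weight < N vanish, [act_swap] makes the
    value of a word invariant under permutation, so it is that of its representative. *)
Lemma order_from_representatives f : S f ->
  (forall s, (wt s < N)%N -> exists2 t, perm_eq s t & act t f a = 0) ->
  forall s, (wt s < N)%N -> act s f a = 0.
Proof.
move=> Sf rep s; have [L] := ubnP (size s); elim: L s => // L IH s.
rewrite ltnS leq_eqVlt => /orP[/eqP sL sN|/IH //].
have [t st <-] := rep s sN.
apply: (@perm_swap_invariant _ _ (fun s => size s = L /\ (wt s < N)%N)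
  (fun s => act s f a)) => // {s t sL sN st}.
- by move=> s t st [<-]; rewrite (perm_size st) (perm_big _ st).
- move=> s1 i j s2 [sL sN]; apply: act_swap => //.
  by rewrite sL; exact: IH.
Qed.

End Weights.

(** * Action of words on monomials in linearly adapted coordinates *)

Section Monomials.
Context (y : 'I_n -> T -> R) (a : T).
Hypothesis Va : V a.
Hypothesis Sy : forall k, S (y k).
Hypothesis y0 : forall k, y k a = 0.
Hypothesis Dy : forall i k, D i (y k) a = (i == k)%:R.

(** The usual, unweighted order of vanishing: letters are counted regardless of their weights. It
    isolates the leading terms of derivatives of monomials. *)
Definition vanishes_to m f := forall s, (size s < m)%N -> act s f a = 0.

Lemma vanishes_to_mul m m' f g : S f -> S g -> vanishes_to m f -> vanishes_to m' g ->
  vanishes_to (m + m') (fun p => f p * g p).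
Proof.
move=> Sf Sg Ff Fg s; elim/last_ind: s m m' f g Sf Sg Ff Fg => [|s i IH].
  move=> [|m] [|m'] // f g _ _ Ff Fg _ /=.
  - by have /= -> := Fg [::] isT; rewrite mulr0.
  - by have /= -> := Ff [::] isT; rewrite mul0r.
  - by have /= -> := Ff [::] isT; rewrite mul0r.
move=> m m' f g Sf Sg Ff Fg; rewrite size_rcons => sm.
(* The truncated predecessor does no harm at k = 0, since vanishing to order 0 is an empty
   condition. *)
have vanishes_to_der k h : vanishes_to k h -> vanishes_to k.-1 (D i h).
  by move=> Fh t tk; rewrite -act_rcons; apply: Fh; rewrite size_rcons; lia.
have SDf := S_der DS i Sf; have SDg := S_der DS i Sg.
rewrite act_mul_rcons// (IH m m'.-1)//; [|exact: vanishes_to_der|lia].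
by rewrite (IH m.-1 m') ?addr0//; [exact: vanishes_to_der|lia].
Qed.

Definition mon s : T -> R := fun p => \prod_(i <- s) y i p.

Lemma mon_cons i s p : mon (i :: s) p = y i p * mon s p.
Proof. exact: big_cons. Qed.

Lemma mon_S s : S (mon s).
Proof.
rewrite /mon; elim: s => [|i s IH].
  by under eq_fun do rewrite big_nil; exact: (S_cst DS 1).
by under eq_fun do rewrite big_cons; exact: (S_mul DS (Sy i) IH).
Qed.

Lemma vanishes_to_coord k : vanishes_to 1 (y k).
Proof. by case=> // _ /=. Qed.

(* To leading order, [D i] is the partial derivative with respect to [y i]. *)
Lemma der_mon i s : exists E : T -> R, [/\ S E, vanishes_to (size s) E &
  forall p, V p ->
    D i (mon s) p = (count_mem i s)%:R * mon (rem i s) p + E p].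
Proof.
elim: s => [|j s [E [SE FE Es]]].
  exists (fun=> 0); split=> // [|p Vp]; first exact: (S_cst DS 0).
  rewrite mul0r addr0 (der_ext DS i (g := fun=> 1) _ Vp) ?(der_cst DS)// => q _.
  exact: big_nil.
pose u p := D i (y j) p + - (i == j)%:R.
have Su : S u by exact: (S_add DS (S_der DS i (Sy j)) (S_cst DS _)).
have Fu : vanishes_to 1 u by case=> // _ /=; rewrite /u Dy subrr.
(* Each summand vanishes to one order more than [size s]: y_j and u vanish at a, while E and [mon s]
   vanish to order [size s]. *)
exists (fun p => y j p * E p + u p * mon s p); split.
- exact: (S_add DS (S_mul DS (Sy j) SE) (S_mul DS Su (mon_S s))).
- move=> t ts.
  rewrite act_add//; [|exact: (S_mul DS (Sy j) SE)|exact: (S_mul DS Su (mon_S s))].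
  rewrite (vanishes_to_mul (Sy j) SE (vanishes_to_coord j) FE ts) add0r.
  suff Fm : vanishes_to (size s) (mon s).
    exact: (vanishes_to_mul Su (mon_S s) Fu Fm ts).
  elim: {E SE FE Es ts t Su Fu} s => // k s IH.
  have := vanishes_to_mul (Sy k) (mon_S s) (vanishes_to_coord k) IH => F t ts.
  rewrite -(F t ts); apply: act_ext => // q _; exact: mon_cons.
move=> p Vp.
rewrite (der_ext DS i (g := fun p => y j p * mon s p) _ Vp); last first.
  by move=> q _; exact: mon_cons.
rewrite (der_mul DS)//; last exact: mon_S.
rewrite Es// /u /= eq_sym; case: eqVneq => [->|ij] /=.
(* Deleting the leading j leaves [mon s]; if j occurs again in s, deleting that occurrence instead
   gives y_j times [mon (rem j s)], the same function. *)
- have -> : (1 + count_mem j s)%:R * mon s p = mon s p +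
      y j p * ((count_mem j s)%:R * mon (rem j s) p).
    rewrite natrD mulrDl mul1r; congr (_ + _).
    have [js|/count_memPn->] := boolP (j \in s); last by rewrite !mul0r mulr0.
    by rewrite mulrCA -mon_cons /mon (perm_big _ (perm_to_rem js)).
  by ring.
- by rewrite add0n mon_cons; ring.
Qed.

(** The innermost letter i of s turns [mon t] into a multiple of the monomial with one i removed,
    plus an error that the remaining letters, fewer than [size t], cannot detect at a. The multiple
    is the number of occurrences of i in t, nonzero in characteristic 0 exactly when i occurs. *)
Lemma act_mon_neq0 s t : (size s <= size t)%N ->
  (act s (mon t) a != 0) = perm_eq s t.
Proof.
elim/last_ind: s t => [|s i IH] t st.
  rewrite /= /mon perm_sym; case: t st => [|j t] _.
    by rewrite big_nil perm_refl oner_eq0.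
  rewrite big_cons y0 mul0r eqxx; apply/esym/negbTE/negP.
  by move=> /perm_size.
rewrite act_rcons; have [E [SE FE Es]] := der_mon i t.
rewrite size_rcons in st.
have Sm := mon_S (rem i t).
rewrite (act_ext s Es Va) act_add ?FE ?addr0//; last exact: S_scale.
rewrite act_scale// mulf_eq0 pnatr_eq0 negb_or -lt0n -has_count has_pred1.
rewrite perm_rcons; have [it|it] /= := boolP (i \in t); last first.
  by apply/esym/negP => /perm_mem/(_ i); rewrite mem_head (negbTE it).
rewrite IH; last by rewrite size_rem//; case: (size t) st.
by rewrite (permPr (perm_to_rem it)) perm_cons.
Qed.

End Monomials.

End Words.

(** * Multi-indices as representatives of words up to permutation *)

Definition mi_word (n m : nat) (al : {ffun 'I_n -> 'I_m}) : seq 'I_n :=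
  flatten [seq nseq (al i) i | i <- enum 'I_n].

Lemma big_mi_word (A : Type) (idx : A) (op : Monoid.com_law idx) n m
    (al : {ffun 'I_n -> 'I_m}) (F : 'I_n -> A) :
  \big[op/idx]_(i <- mi_word al) F i =
  \big[op/idx]_(i < n) iter (al i) (op (F i)) idx.
Proof.
rewrite big_flatten big_map big_enum.
by apply: eq_bigr => i _; rewrite big_nseq.
Qed.

Lemma count_mi_word n m (al : {ffun 'I_n -> 'I_m}) i :
  count_mem i (mi_word al) = al i.
Proof.
rewrite -sum1_count big_mkcond big_mi_word (bigD1 i)//= eqxx big1 ?addn0.
  by rewrite iter_addn_0 mul1n.
by move=> j /negbTE ji; rewrite ji iter_addn_0 mul0n.
Qed.

Lemma size_mi_word n m (al : {ffun 'I_n -> 'I_m}) :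
  size (mi_word al) = (\sum_i al i)%N.
Proof.
rewrite -sum1_size big_mi_word.
by apply: eq_bigr => i _; rewrite iter_addn_0 mul1n.
Qed.

Lemma sum_mi_word n m (al : {ffun 'I_n -> 'I_m}) (w : 'I_n -> nat) :
  (\sum_(i <- mi_word al) w i)%N = (\sum_i w i * al i)%N.
Proof. by rewrite big_mi_word; apply: eq_bigr => i _; rewrite iter_addn_0. Qed.

Lemma perm_mi_word n m (al be : {ffun 'I_n -> 'I_m}) :
  perm_eq (mi_word al) (mi_word be) = (al == be).
Proof.
apply/idP/eqP => [/permP E|->]; last exact: perm_refl.
by apply/ffunP => i; apply: val_inj; rewrite /= -!count_mi_word E.
Qed.

Lemma perm_to_mi_word n m (s : seq 'I_n) : (size s <= m)%N ->
  exists al : {ffun 'I_n -> 'I_m.+1}, perm_eq s (mi_word al).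
Proof.
move=> sm; exists [ffun i => inord (count_mem i s)].
apply/allP => i _ /=; rewrite count_mi_word ffunE inordK//.
by rewrite ltnS (leq_trans (count_size _ _)).
Qed.

(** * Correcting a function by a polynomial to reach weighted order N *)

Section Correction.
Context (R : realFieldType) (T : Type) (n : nat) (V : T -> Prop)
  (S : (T -> R) -> Prop) (D : 'I_n -> (T -> R) -> T -> R).
Hypothesis DS : derivations V S D.
Context (w : 'I_n -> nat) (a : T) (N m : nat).
Hypothesis Va : V a.
Hypothesis w_gt0 : forall i, (0 < w i)%N.
Hypothesis Nm : (N <= m.+1)%N.
Hypothesis brackets : forall i j, (w i + w j < N)%N ->
  structure_functions V S D w i j.
Context (y : 'I_n -> T -> R).
Hypothesis Sy : forall k, S (y k).
Hypothesis y0 : forall k, y k a = 0.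
Hypothesis Dy : forall i k, D i (y k) a = (i == k)%:R.
Context (g : T -> R).
Hypothesis Sg : S g.
Hypothesis g0 : g a = 0.
Hypothesis Dg : forall i, (w i < N)%N -> D i g a = 0.

Local Notation act := (word_act D).
Local Notation wt s := (\sum_(i <- s) w i)%N.

Let P (al : {ffun 'I_n -> 'I_m.+1}) :=
  (\sum_i w i * al i < N)%N && (2 <= \sum_i al i)%N.

Let PE al : P al = (wt (mi_word al) < N)%N && (2 <= size (mi_word al))%N.
Proof. by rewrite /P size_mi_word sum_mi_word. Qed.

(** With g = y_k and N = w_k this is the k-th component of the corrected coordinates. The condition
    on multi-indices is spelled out so as to be convertible with the one in [psi_hat_form]. *)
Definition correction (A : {ffun 'I_n -> 'I_m.+1} -> R) : T -> R := fun p =>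
  g p + \sum_(al : {ffun 'I_n -> 'I_m.+1} |
           (\sum_i w i * al i < N)%N && (2 <= \sum_i al i)%N)
          A al * \prod_(i < n) y i p ^+ al i.

Let correctionE A p :
  correction A p = g p + \sum_(al | P al) A al * mon y (mi_word al) p.
Proof.
rewrite /correction; congr (_ + _); apply: eq_bigr => al _; congr (_ * _).
rewrite /mon big_mi_word; apply: eq_bigr => i _.
by elim: (nat_of_ord _) => [|k IH]; rewrite ?expr0 // exprS IH.
Qed.

Lemma S_correction A : S (correction A).
Proof.
rewrite (_ : correction A =
  fun p => g p + \sum_(al | P al) A al * mon y (mi_word al) p); last first.
  by apply/funext => p; exact: correctionE.
apply: (S_add DS Sg); apply: (S_sum DS) => al _.
exact: (S_scale DS (A al) (mon_S DS Sy (mi_word al))).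
Qed.

Lemma act_correction A s : act s (correction A) a =
  act s g a + \sum_(al | P al) act s (mon y (mi_word al)) a * A al.
Proof.
have Sm (al : {ffun 'I_n -> 'I_m.+1}) := mon_S DS Sy (mi_word al).
have SAm (al : {ffun 'I_n -> 'I_m.+1}) : S (fun p => A al * mon y (mi_word al) p).
  exact: (S_scale DS (A al) (Sm al)).
rewrite (act_ext DS s (fun p _ => correctionE A p) Va).
rewrite (act_add DS)//; last by apply: (S_sum DS) => al _; exact: SAm.
rewrite (act_sum DS)//; congr (_ + _); apply: eq_bigr => al _.
by rewrite (act_scale DS)// mulrC.
Qed.

(** A product of at least two functions vanishing at a has value and first derivatives zero there.
    The correction thus keeps coordinates centered and linearly adapted. *)
Lemma act_correction_short A s : (size s < 2)%N ->
  act s (correction A) a = act s g a.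
Proof.
move=> s2; rewrite act_correction big1 ?addr0// => be.
rewrite PE => /andP[_ be2].
have := act_mon_neq0 DS Va Sy y0 Dy (leq_trans (ltnW s2) be2).
case: eqP => [->|_]; first by rewrite mul0r.
by move=> /esym/perm_size E; rewrite E ltnNge be2 in s2.
Qed.

Lemma wt_ge_size s : (size s <= wt s)%N.
Proof. by rewrite -sum1_size; apply: leq_sum => i _; exact: w_gt0. Qed.

Let b (al : {ffun 'I_n -> 'I_m.+1}) := - act (mi_word al) g a.
Let M (al be : {ffun 'I_n -> 'I_m.+1}) := act (mi_word al) (mon y (mi_word be)) a.

(** One equation per multi-index suffices by [order_from_representatives]. Those of length at least
    2 form the system; those of length 0 and 1 hold beforehand, by the hypotheses on g. *)
Lemma order_correctionP A :
  (forall s, (wt s < N)%N -> act s (correction A) a = 0) <->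
  (forall al, P al -> \sum_(be | P be) M al be * A be = b al).
Proof.
split=> [ord al|sys].
  rewrite PE => /andP[alN _]; have := ord _ alN.
  by rewrite act_correction => /eqP; rewrite addr_eq0 /b => /eqP ->; rewrite opprK.
apply: (order_from_representatives DS Va brackets (S_correction A)) => s sN.
(* Weights are positive, so the length of s is at most its weight, which is < N <= m + 1: the
   exponents fit into ['I_m.+1]. *)
have [|al sal] := @perm_to_mi_word n m s.
  by rewrite -ltnS; apply: leq_trans Nm; apply: leq_ltn_trans sN; exact: wt_ge_size.
exists (mi_word al) => //.
have alN : (wt (mi_word al) < N)%N by rewrite -(perm_big _ sal).
have [al2|al2] := leqP 2 (size (mi_word al)).
  by rewrite act_correction sys ?PE ?alN// /b subrr.
rewrite act_correction_short//.
case: (mi_word al) al2 alN => [|i [|//]] _ //=.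
by rewrite big_seq1; exact: Dg.
Qed.

Let M_tri al be : P al -> P be -> (size (mi_word al) <= size (mi_word be))%N ->
  (M al be != 0) = (al == be).
Proof.
move=> _ _ sz; rewrite -perm_mi_word.
exact: (act_mon_neq0 DS Va Sy y0 Dy sz).
Qed.

Lemma correction_exists :
  exists A, forall s, (wt s < N)%N -> act s (correction A) a = 0.
Proof.
have [A HA] := triangular_solvable M_tri b.
by exists A; apply/order_correctionP.
Qed.

Lemma correction_unique A A' :
  (forall s, (wt s < N)%N -> act s (correction A) a = 0) ->
  (forall s, (wt s < N)%N -> act s (correction A') a = 0) ->
  forall al : {ffun 'I_n -> 'I_m.+1},
    (\sum_i w i * al i < N)%N && (2 <= \sum_i al i)%N -> A al = A' al.
Proof.
move=> /order_correctionP sA /order_correctionP sA' al Pal.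
by apply: (triangular_unique M_tri) Pal => be Pbe; rewrite sA// sA'.
Qed.

End Correction.

(** * Smooth functions and vector fields on a manifold *)

Section ChartLemmas.
Context (R : realType) (n : nat) (M : topologicalType).
Implicit Types (c d : chart R n M) (A : set M).

Lemma cinvK c y : (c @` cdom c) y -> cdom c (cinv c y) /\ c (cinv c y) = y.
Proof. by case=> p cp <-; rewrite cmapK. Qed.

Lemma chart_imageP c A y : (c @` (A `&` cdom c)) y <->
  (c @` cdom c) y /\ A (cinv c y).
Proof.
split=> [[p [Ap cp] <-]|[/cinvK[cy Ey] Ay]].
  by split; [exists p|rewrite cmapK].
by exists (cinv c y).
Qed.

Lemma open_chart_image c A : open A -> open (c @` (A `&` cdom c)).
Proof.
move=> oA; rewrite openE => y /chart_imageP[cy Ay].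
have H1 : nbhs y (c @` cdom c).
  by apply: open_nbhs_nbhs; split=> //; exact: open_cimg.
have H2 : nbhs y (cinv c @^-1` A).
  by apply: (cinv_continuous cy); apply: open_nbhs_nbhs.
by apply: filterS2 H1 H2 => z cz Az; apply/chart_imageP.
Qed.

Lemma compatible_sym c d : compatible c d -> compatible d c.
Proof. by case=> h1 h2; rewrite /compatible setIC. Qed.

End ChartLemmas.

Section TangentMap.
Context (R : realType) (n : nat) (M : manifold R n).
Implicit Types (c : chart R n M) (p q a : M) (v : 'rV[R]_n).

Lemma transition_differentiable c d p : compatible c d -> cdom c p -> cdom d p ->
  differentiable (d \o cinv c) (c p).
Proof.
move=> [cd _] cp dp.
have oU : open (c @` (cdom c `&` cdom d)).
  by rewrite setIC; apply: open_chart_image; exact: open_cdom.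
by apply: Ck_differentiable_rV oU (cd 1%N) _; exists p.
Qed.

(** [tangent_map] refers to the chart attached to p; the chain rule for the transition map transfers
    it to any compatible chart around p. *)
Lemma tangent_map_chart (W : normedModType R) (f : M -> W) c p v :
  compatible c (chart_at p) -> cdom c p -> differentiable (f \o cinv c) (c p) ->
  tangent_map f p v = 'D_(tangent_map c p v) (f \o cinv c) (c p).
Proof.
move=> cc cp df; set phi := chart_at p; have pp : cdom phi p := mem_chart_at p.
have dT : differentiable (c \o cinv phi) (phi p).
  exact: transition_differentiable (compatible_sym cc) pp cp.
have E : (c \o cinv phi) (phi p) = c p by rewrite /= cmapK.
rewrite -E in df.
rewrite /tangent_map -[in RHS]E -(derive_comp v dT df).
apply: near_eq_derive; have oU := @open_chart_image _ _ _ phi _ (open_cdom c).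
have : nbhs (phi p) (phi @` (cdom c `&` cdom phi)).
  by apply: open_nbhs_nbhs; split=> //; exists p.
by apply: filterS => _ [q [cq pq] <-] /=; rewrite !cmapK.
Qed.

(** J is the Jacobian matrix of a transition map, and the reverse transition provides its
    inverse. *)
Lemma tangent_map_mx c p : compatible c (chart_at p) -> cdom c p ->
  exists2 J : 'M[R]_n, J \in unitmx & forall v, tangent_map c p v = v *m J.
Proof.
move=> cc cp; set phi := chart_at p; have pp : cdom phi p := mem_chart_at p.
have dT : differentiable (c \o cinv phi) (phi p).
  exact: transition_differentiable (compatible_sym cc) pp cp.
have dT' : differentiable (phi \o cinv c) (c p).
  exact: transition_differentiable.
have [J EJ] : exists J : 'M[R]_n, forall v, tangent_map c p v = v *m J.
  by exists (jacobian (c \o cinv phi) (phi p)) => v; exact: deriveEjacobian dT.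
have [J' EJ'] : exists J' : 'M[R]_n,
    forall u, 'D_u (phi \o cinv c) (c p) = u *m J'.
  by exists (jacobian (phi \o cinv c) (c p)) => v; exact: deriveEjacobian dT'.
have K (v : 'rV[R]_n) : v *m J *m J' = v.
  rewrite -EJ -EJ' -(tangent_map_chart v cc cp dT').
  rewrite -[RHS](@derive_id _ _ (phi p)); apply: near_eq_derive.
  have : nbhs (phi p) (phi @` cdom phi).
    by apply: open_nbhs_nbhs; split; [exact: open_cimg|exists p].
  by apply: filterS => _ [q pq <-] /=; rewrite cmapK.
exists J; last exact: EJ.
have /mulmx1_unit[uJ _] : J *m J' = 1%:M; last exact: uJ.
by apply/row_matrixP => i; rewrite !rowE mulmxA K mulmx1.
Qed.

End TangentMap.

Section SmoothFunctions.
Context (R : realType) (n : nat) (M : manifold R n) (V : set M).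
Hypothesis oV : open V.

Definition smooth_fun (f : M -> R) : Prop :=
  forall q, smooth_on (chart_at q @` (V `&` cdom (chart_at q)))
                      (f \o cinv (chart_at q) : 'rV[R]_n -> R^o).

Lemma smooth_fun_differentiable f q p : smooth_fun f -> V p ->
  cdom (chart_at q) p ->
  differentiable (f \o cinv (chart_at q) : 'rV[R]_n -> R^o) (chart_at q p).
Proof.
move=> Sf Vp qp; have oU := @open_chart_image _ _ _ (chart_at q) _ oV.
by apply: Ck_differentiable oU (Sf q 1%N) _; exists p.
Qed.

(** [vf_act] uses a chart that varies with the point. Fixing one chart turns it into a directional
    derivative on an open set of R^n, to which calculus applies. *)
Lemma vf_act_chart X f q y : smooth_fun f ->
  (chart_at q @` (V `&` cdom (chart_at q))) y ->
  vf_act X f (cinv (chart_at q) y) =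
  'D_(vf_coord (chart_at q) X y) (f \o cinv (chart_at q) : 'rV[R]_n -> R^o) y.
Proof.
move=> Sf [p [Vp qp] <-]; rewrite /vf_act /vf_coord cmapK//.
apply: tangent_map_chart => //; first exact: chart_at_compatible.
exact: smooth_fun_differentiable.
Qed.

Lemma vf_act_smooth X f : smooth_vfield V X -> smooth_fun f ->
  smooth_fun (vf_act X f).
Proof.
move=> SX Sf q k; have oU := @open_chart_image _ _ _ (chart_at q) _ oV.
apply: Ck_ext (smooth_derive oU (Sf q) (SX q) k) => // y Uy.
by rewrite /= vf_act_chart.
Qed.

Lemma vf_act_derivations (X : 'I_n -> M -> 'rV[R]_n) :
  (forall i, smooth_vfield V (X i)) ->
  derivations V smooth_fun (fun i => vf_act (X i)).
Proof.
move=> SX; have oU q := @open_chart_image _ _ _ (chart_at q) _ oV.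
have df f p v : smooth_fun f -> V p ->
    derivable (f \o cinv (chart_at p) : 'rV[R]_n -> R^o) (chart_at p p) v.
  move=> Sf Vp; apply: diff_derivable; apply: smooth_fun_differentiable => //.
  exact: mem_chart_at.
split.
- by move=> c q k; exact: (Ck_cst k _ (c : R^o)).
- by move=> f g Sf Sg q k; exact: (CkD (oU q) (Sf q k) (Sg q k)).
- by move=> f g Sf Sg q k; exact: (CkM (oU q) (Sf q k) (Sg q k)).
- by move=> i f Sf; exact: vf_act_smooth.
- move=> i f g p fg Vp; apply: near_eq_derive.
  have : nbhs (chart_at p p) (chart_at p @` (V `&` cdom (chart_at p))).
    by apply: open_nbhs_nbhs; split=> //; exists p; split=> //; exact: mem_chart_at.
  by apply: filterS => _ [q [Vq pq] <-] /=; rewrite cmapK// fg.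
- by move=> i c p _; exact: derive_cst.
- move=> i f g p Sf Sg Vp.
  exact: (deriveD (df _ _ _ Sf Vp) (df _ _ _ Sg Vp)).
- move=> i f g p Sf Sg Vp.
  have := deriveM (df _ _ (X i p) Sf Vp) (df _ _ (X i p) Sg Vp).
  rewrite /= cmapK; last exact: mem_chart_at.
  by move=> E; apply: (etrans E); congr (_ + _); exact: mulrC.
Qed.

End SmoothFunctions.

(** * The Lie bracket as a commutator of derivations *)

Section LieBracket.
Context (R : realType) (n : nat).

Lemma smooth_partial_comm (U : set 'rV[R]_n) (F : 'rV[R]_n -> R^o)
    (y : 'rV[R]_n) i j : open U -> smooth_on U F -> U y ->
  'D_(delta_mx 0 i) ('D_(delta_mx 0 j) F) y =
  'D_(delta_mx 0 j) ('D_(delta_mx 0 i) F) y.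
Proof.
move=> oU SF Uy.
have c2 k l := Ck_partial l (Ck_partial k (SF 2%N)).
apply: derive_comm.
- apply: filterS (open_nbhs_nbhs (conj oU Uy)) => z Uz; split.
  + exact: (Ck_derivable j (SF 1%N) Uz).
  + exact: (Ck_derivable i (SF 1%N) Uz).
  + exact: (Ck_derivable i (Ck_partial j (SF 2%N)) Uz).
  + exact: (Ck_derivable j (Ck_partial i (SF 2%N)) Uz).
- exact: (Ck_continuous (c2 j i) Uy).
- exact: (Ck_continuous (c2 i j) Uy).
Qed.

Lemma derive_vf_act (U : set 'rV[R]_n) (F : 'rV[R]_n -> R^o)
    (eta : 'rV[R]_n -> 'rV[R]_n) (y u : 'rV[R]_n) :
  open U -> smooth_on U F -> smooth_on U eta -> U y ->
  'D_u (fun z => 'D_(eta z) F z) y = 'D_('D_u eta y) F y +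
    \sum_k \sum_l eta y 0 k * (u 0 l *
      'D_(delta_mx 0 l) ('D_(delta_mx 0 k) F) y).
Proof.
move=> oU SF Seta Uy.
have dF z : U z -> differentiable F z by exact: Ck_differentiable oU (SF 1%N).
have dp k : differentiable ('D_(delta_mx 0 k) F) y.
  exact: Ck_differentiable oU (Ck_partial k (SF 2%N)) Uy.
have deta : differentiable eta y by exact: Ck_differentiable_rV oU (Seta 1%N) Uy.
have detak k : derivable (fun z => eta z 0 k : R^o) y u.
  by apply: (derivable_rVP _ _ _).1; exact: diff_derivable.
pose h k (z : 'rV[R]_n) : R^o := eta z 0 k * 'D_(delta_mx 0 k) F z.
have dh k : derivable (h k) y u.
  exact: derivableM (detak k) (diff_derivable (dp k)).
have -> : 'D_u (fun z => 'D_(eta z) F z) y = 'D_u (\sum_k h k) y.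
  apply: near_eq_derive; apply: filterS (open_nbhs_nbhs (conj oU Uy)) => z Uz.
  by rewrite fct_sumE (derive_sum_coord _ (dF _ Uz)).
rewrite (derive_sum dh) (derive_sum_coord _ (dF _ Uy)) -big_split /=.
apply: eq_bigr => k _.
have -> : 'D_u (h k) y = eta y 0 k *: 'D_u ('D_(delta_mx 0 k) F) y +
    'D_(delta_mx 0 k) F y *: 'D_u (fun z => eta z 0 k : R^o) y.
  exact: deriveM (detak k) (diff_derivable (dp k)).
rewrite addrC -(derive_rVE k (diff_derivable deta)); congr (_ + _).
  rewrite (derive_sum_coord _ (dp k)) scaler_sumr.
  exact: eq_bigr.
exact: mulrC.
Qed.

(** The second-order terms of both iterated derivatives coincide by symmetry; the first-order terms
    differ by the derivative along the bracket. *)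
Lemma derive_lie (U : set 'rV[R]_n) (F : 'rV[R]_n -> R^o)
    (xi eta : 'rV[R]_n -> 'rV[R]_n) (y : 'rV[R]_n) :
  open U -> smooth_on U F -> smooth_on U xi -> smooth_on U eta -> U y ->
  'D_(xi y) (fun z => 'D_(eta z) F z) y =
  'D_(eta y) (fun z => 'D_(xi z) F z) y +
  'D_('D_(xi y) eta y - 'D_(eta y) xi y) F y.
Proof.
move=> oU SF Sxi Seta Uy.
have dF : differentiable F y by exact: Ck_differentiable oU (SF 1%N) Uy.
have D (u v : 'rV[R]_n) : 'D_(u - v) F y = 'D_u F y - 'D_v F y.
  by rewrite !(deriveE _ dF) linearB.
have E1 := derive_vf_act (xi y) oU SF Seta Uy.
have E2 := derive_vf_act (eta y) oU SF Sxi Uy.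
set s1 := \sum_k _ in E1; set s2 := \sum_k _ in E2.
have s12 : s1 = s2.
  rewrite /s1 /s2 exchange_big /=; apply: eq_bigr => k _; apply: eq_bigr => l _.
  rewrite (smooth_partial_comm _ _ oU SF Uy); exact: mulrCA.
have alg (p q s : R^o) : p + s = q + s + (p - q).
  by rewrite [RHS]addrC addrA subrK.
rewrite D; apply: (etrans E1); rewrite s12.
have := alg ('D_('D_(xi y) eta y) F y) ('D_('D_(eta y) xi y) F y) s2.
move=> H; exact: (etrans H (congr1 (fun t : R^o => t + _) (esym E2))).
Qed.

Lemma vf_act_lie_bracket (M : manifold R n) (V : set M) X Y (f : M -> R) p :
  open V -> smooth_vfield V X -> smooth_vfield V Y -> smooth_fun V f -> V p ->
  vf_act X (vf_act Y f) p =
  vf_act Y (vf_act X f) p + vf_act (lie_bracket X Y) f p.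
Proof.
move=> oV SX SY Sf Vp; set phi := chart_at p.
have pp : cdom phi p by exact: mem_chart_at.
have oU := @open_chart_image _ _ _ phi _ oV.
have Up : (phi @` (V `&` cdom phi)) (phi p) by exists p.
(* Tangent vectors at p are encoded by their coordinates in this very chart. *)
have idp (Z : M -> 'rV[R]_n) : Z p = vf_coord phi Z (phi p).
  rewrite /vf_coord cmapK// /tangent_map -/phi.
  rewrite -[LHS](@derive_id _ _ (phi p)); apply: near_eq_derive.
  have : nbhs (phi p) (phi @` cdom phi).
    by apply: open_nbhs_nbhs; split; [exact: open_cimg|exists p].
  by apply: filterS => _ [q pq <-] /=; rewrite cmapK.
have act2 (Z W : M -> 'rV[R]_n) :
    vf_act Z (vf_act W f) p = 'D_(vf_coord phi Z (phi p))
      (fun y => 'D_(vf_coord phi W y) (f \o cinv phi : _ -> R^o) y) (phi p).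
  rewrite {1}/vf_act /tangent_map -/phi -idp; apply: near_eq_derive.
  apply: filterS (open_nbhs_nbhs (conj oU Up)) => y Uy.
  exact: (vf_act_chart oV W Sf Uy).
have E := derive_lie oU (Sf p) (SX p) (SY p) Up.
have L : lie_bracket X Y p =
    'D_(vf_coord phi X (phi p)) (vf_coord phi Y) (phi p) -
    'D_(vf_coord phi Y (phi p)) (vf_coord phi X) (phi p).
  by rewrite -!idp.
rewrite -L in E.
exact: (etrans (act2 X Y) (etrans E (congr1 (fun t : R^o => t + _)
  (esym (act2 Y X))))).
Qed.

End LieBracket.

(** * Weights and brackets of an H-frame *)

Lemma bigminn_le (r : seq nat) (P : pred nat) (x0 x : nat) :
  x \in r -> P x -> (\big[minn/x0]_(w <- r | P w) w <= x)%N.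
Proof.
move=> + Px; elim: r => // w r IH; rewrite in_cons big_cons => /orP[/eqP<-|/IH xr].
  by rewrite Px geq_minl.
by case: ifP => // _; rewrite (leq_trans (geq_minr _ _)).
Qed.

Section Weights.
Context (R : realType) (n : nat) (M : carnot_manifold R n).
Implicit Types (p : M) (w : nat).

(* The point [p] in these statements is needed: [rk M] is unconstrained when
   [M] is empty. *)
Lemma dim_H w p : (1 <= w <= step M)%N -> \dim (H w p) = rk M w.
Proof.
move=> w_step; have [V [Y [[_ Vp] _ bY]]] := H_subbundle w_step p.
exact: size_basis (bY _ Vp).
Qed.

Lemma dim_row_space : \dim {:'rV[R]_n} = n.
Proof. by rewrite dimvf /dim /= mul1n. Qed.

Lemma rk_step p : rk M (step M) = n.
Proof.
by rewrite -(dim_H p) ?step_gt0 ?leqnn// H_step dim_row_space.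
Qed.

Lemma rk_le w w' p : (1 <= w)%N -> (w <= w')%N -> (w' <= step M)%N ->
  (rk M w <= rk M w')%N.
Proof.
move=> w1; elim: w' => [|w' IH]; first by case: w w1.
rewrite leq_eqVlt => /orP[/eqP->//|]; rewrite ltnS => ww' w's.
have w'1 : (1 <= w')%N := leq_trans w1 ww'.
apply: leq_trans (IH ww' (ltnW w's)) _.
rewrite -!(dim_H p) ?(ltnW w's) ?w'1//.
by apply: dimvS; apply: H_filtration; rewrite w'1.
Qed.

Lemma weight_spec p (j : 'I_n) :
  [&& 1 <= weight M j, weight M j <= step M & j < rk M (weight M j)]%N.
Proof.
rewrite /weight big_nat_cond.
apply: (big_ind (fun w => [&& 1 <= w, w <= step M & j < rk M w]%N)).
- by rewrite step_gt0 leqnn (rk_step p) ltn_ord.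
- by move=> w w' hw hw'; rewrite /minn; case: ifP.
- by move=> w /andP[/andP[-> +] ->]; rewrite ltnS => ->.
Qed.

Lemma weight_gt0 p j : (0 < weight M j)%N.
Proof. by case/and3P: (weight_spec p j). Qed.

Lemma weight_le_step p j : (weight M j <= step M)%N.
Proof. by case/and3P: (weight_spec p j). Qed.

(** As the ranks increase with w, the minimum defining the weight becomes an equivalence. Since j
    counts from 0, [j < rk M w] is the condition j + 1 <= rk H_w. *)
Lemma weight_leP p w (j : 'I_n) : (1 <= w <= step M)%N ->
  (weight M j <= w)%N = (j < rk M w)%N.
Proof.
move=> /andP[w1 ws]; apply/idP/idP => [jw|jw].
  case/and3P: (weight_spec p j) => j1 js; move/leq_trans; apply.
  exact: rk_le p _ _ _.
by apply: bigminn_le => //; rewrite mem_index_iota w1.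
Qed.

(** The frame vectors of weight at most w lie in H_w and there are rk H_w of them. The remaining n -
    rk H_w vectors span at most that many dimensions, so the former span all of H_w. *)
Lemma frame_span_H (X : 'I_n -> 'rV[R]_n) w p v : (1 <= w <= step M)%N ->
  basis_of fullv (mktuple X) -> (forall j, X j \in H (weight M j) p) ->
  v \in H w p ->
  exists2 d : 'I_n -> R, (forall j, (w < weight M j)%N -> d j = 0) &
    v = \sum_j d j *: X j.
Proof.
move=> ws bX XH vH; have /andP[w1 wst] := ws.
pose P (j : 'I_n) := (weight M j <= w)%N.
pose U := (\sum_(j | P j) <[X j]>)%VS.
have UH : (U <= H w p)%VS.
  apply/subv_sumP => j Pj; rewrite -memvE; apply: subvP (XH j).
  have sub w' : (weight M j <= w')%N -> (w' <= step M)%N ->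
      (H (weight M j) p <= H w' p)%VS.
    elim: w' => [|w' IH]; first by rewrite leqNgt weight_gt0.
    rewrite leq_eqVlt => /orP[/eqP->//|]; rewrite ltnS => jw' w's.
    apply: subv_trans (IH jw' (ltnW w's)) _; apply: H_filtration.
    by rewrite w's (leq_trans (weight_gt0 p j)).
  exact: sub.
have full : (U + \sum_(j | ~~ P j) <[X j]>)%VS = fullv.
  rewrite -(span_basis bX) span_def big_tuple; symmetry.
  rewrite (bigID P) /=; congr (_ + _)%VS; apply: eq_bigr => j _;
    by rewrite tnth_mktuple.
have dimle (Q : pred 'I_n) : (\dim (\sum_(j | Q j) <[X j]>)%VS <= #|Q|)%N.
  have /leq_trans := dimv_leq_sum (index_enum 'I_n) Q (fun j => <[X j]>%VS).
  apply; rewrite -sum1_card.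
  by apply: leq_sum => j _; rewrite dim_vline; case: (_ == _).
have cardP : #|P| = rk M w.
  have kn : (rk M w <= n)%N.
    by rewrite -(dim_H p ws) -[X in (_ <= X)%N]dim_row_space dimvS// subvf.
  rewrite -[RHS](card_ord (rk M w)).
  have winj : injective (widen_ord kn).
    by move=> i j /(congr1 val) /= ij; exact: val_inj.
  rewrite -(card_codom winj); apply: eq_card => j.
  rewrite unfold_in /P (weight_leP p)//.
  apply/idP/codomP => [jk|[i ->]]; last exact: (ltn_ord i).
  by exists (Ordinal jk); apply: val_inj.
have UE : U = H w p.
  apply/eqP; rewrite eqEdim UH (dim_H p ws) -cardP.
  have := dimv_add_leqif U (\sum_(j | ~~ P j) <[X j]>)%VS => -[+ _].
  rewrite full dim_row_space => h.
  have h2 := dimle (predC P); have := cardC P; rewrite card_ord => cPn.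
  rewrite /= -(leq_add2r #|predC P|) cPn; apply: (leq_trans h).
  by rewrite leq_add2l.
move: vH; rewrite -UE => /memv_sumP[vs vsX ->].
have /choice[d Hd] : forall j, exists c : R, P j -> vs j = c *: X j.
  move=> j; have [Pj|Pj] := boolP (P j); last by exists 0.
  by have /vlineP[c ->] := vsX _ Pj; exists c.
exists (fun j => if P j then d j else 0).
  by move=> j; rewrite ltnNge /P => /negbTE ->.
rewrite [RHS](bigID P) /= [X in _ + X]big1 ?addr0.
  by apply: eq_bigr => j Pj; rewrite Pj Hd.
by move=> j /negbTE ->; rewrite scale0r.
Qed.

End Weights.

Lemma basis_unitmx (R : fieldType) n (X : 'I_n -> 'rV[R]_n) :
  basis_of fullv (mktuple X) -> \matrix_k X k \in unitmx.
Proof.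
move=> bX; pose D := \matrix_(i, j) coord (mktuple X) j (delta_mx 0 i : 'rV[R]_n).
have /mulmx1_unit[_ uX] : D *m (\matrix_k X k) = 1%:M; last exact: uX.
apply/row_matrixP => i; rewrite row_mul row1 mulmx_sum_row.
rewrite [RHS](coord_basis bX (memvf _)); apply: eq_bigr => k _.
by rewrite !mxE rowK -tnth_nth tnth_mktuple.
Qed.

Section FrameBrackets.
Context (R : realType) (n : nat) (M : carnot_manifold R n) (V : set M)
  (X : 'I_n -> M -> 'rV[R]_n).
Hypothesis oV : open V.
Hypothesis hX : H_frame V X.

(** Passing to another chart multiplies L and the frame by the same Jacobian matrix, which cancels
    in the coefficients. They can thus be computed in one fixed chart, where matrix inversion
    preserves smoothness. *)
Lemma smooth_frame_coord (L : M -> 'rV[R]_n) k : smooth_vfield V L ->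
  smooth_fun V (fun p => (L p *m invmx (\matrix_l X l p)) 0 k).
Proof.
move=> SL q r; have [SX bX] := hX.
have oU := @open_chart_image _ _ _ (chart_at q) _ oV.
set U := (_ @` _) in oU *.
pose A y : 'M[R]_n := \matrix_l vf_coord (chart_at q) (X l) y.
have key y : U y -> A y \in unitmx /\
    vf_coord (chart_at q) L y *m invmx (A y) =
    L (cinv (chart_at q) y) *m invmx (\matrix_l X l (cinv (chart_at q) y)).
  move=> /chart_imageP[/cinvK[cy _] Vy].
  have [J uJ EJ] := tangent_map_mx (chart_at_compatible q _) cy.
  have -> : A y = (\matrix_l X l (cinv (chart_at q) y)) *m J.
    apply/row_matrixP => l; rewrite row_mul !rowK; exact: EJ.
  have uX := basis_unitmx (bX _ Vy).
  have uXJ : (\matrix_l X l (cinv (chart_at q) y)) *m J \in unitmx.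
    by rewrite unitmx_mul uX.
  split=> //; rewrite /vf_coord EJ.
  by rewrite -[in LHS](mulmxKV uX (L _)) -(mulmxA _ _ J) mulmxK.
have cA i j : Ck r U (fun y => A y i j : R^o).
  apply: Ck_ext ((Ck_rVP _ _ oU).1 ((SX i).1 q r) j) => // y _.
  by rewrite mxE.
have cS : Ck r U (fun y => \sum_j vf_coord (chart_at q) L y 0 j *
    invmx (A y) j k : R^o).
  apply: Ck_sum => // j _; apply: CkM => //.
    exact: ((Ck_rVP _ _ oU).1 (SL q r) j).
  by apply: Ck_invmx => // y /key[].
apply: Ck_ext cS => // y Uy.
by rewrite /= -(key _ Uy).2 [RHS]mxE.
Qed.

Lemma frame_brackets (a : M) i j : V a -> (weight M i + weight M j <= step M)%N ->
  structure_functions V (smooth_fun V) (fun i => vf_act (X i)) (weight M) i j.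
Proof.
move=> Va wij; have [SX bX] := hX.
pose L := lie_bracket (X i) (X j).
pose c k p := (L p *m invmx (\matrix_l X l p)) 0 k.
have secL : is_section V (H (weight M i + weight M j)%N) L.
  apply: H_bracket => //; exact: weight_gt0 a _.
have Lc p : V p -> L p = \sum_k c k p *: X k p.
  move=> Vp; rewrite -[LHS](mulmxKV (basis_unitmx (bX _ Vp))) mulmx_sum_row.
  by apply: eq_bigr => k _; rewrite rowK.
exists c; split.
- by move=> k; apply: smooth_frame_coord; exact: secL.1.
- move=> k p Vp wk.
  have ws : (1 <= weight M i + weight M j <= step M)%N.
    by rewrite wij addn_gt0 (weight_gt0 p).
  have XH l : X l p \in H (weight M l) p by exact: (SX l).2.
  (* The bracket lies in H of weight w_i + w_j; as coefficients in a frame are unique, [c k p] is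
     [d k], which vanishes for larger weights. *)
  have [d d0 E] := frame_span_H ws (bX _ Vp) XH (secL.2 _ Vp).
  rewrite /c E; apply: etrans (d0 _ wk).
  have -> : \sum_l d l *: X l p = (\row_l d l) *m (\matrix_l X l p).
    by rewrite mulmx_sum_row; apply: eq_bigr => l _; rewrite mxE rowK.
  by rewrite (mulmxK (basis_unitmx (bX _ Vp))) mxE.
- move=> f p Sf Vp.
  rewrite (vf_act_lie_bracket oV (SX i).1 (SX j).1 Sf Vp); congr (_ + _).
  have df := smooth_fun_differentiable oV Sf Vp (mem_chart_at p).
  rewrite /vf_act /tangent_map -/L (Lc _ Vp) (deriveE _ df) linear_sum.
  by apply: eq_bigr => k _; rewrite linearZ /= (deriveE _ df).
Qed.

End FrameBrackets.

(** * Polynomial changes of coordinates *)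

(** Global on R^n with an explicit inverse, so that composition with a chart keeps its domain and
    provides its inverse map. *)
Definition diffeo (R : realType) n (G G' : 'rV[R]_n -> 'rV[R]_n) : Prop :=
  [/\ smooth_on setT G, smooth_on setT G', cancel G G' & cancel G' G].

Lemma diffeo_comp (R : realType) n (F F' G G' : 'rV[R]_n -> 'rV[R]_n) :
  diffeo F F' -> diffeo G G' -> diffeo (G \o F) (F' \o G').
Proof.
move=> [SF SF' FK F'K] [SG SG' GK G'K]; split.
- by move=> k; apply: (Ck_comp openT openT) (SG k) (SF k).
- by move=> k; apply: (Ck_comp openT openT) (SF' k) (SG' k).
- exact: can_comp.
- exact: can_comp.
Qed.

Section ChartChange.
Context (R : realType) (n : nat).

Lemma chart_comp (M : topologicalType) (c : chart R n M)
    (G G' : 'rV[R]_n -> 'rV[R]_n) : diffeo G G' ->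
  exists c' : chart R n M, [/\ cdom c' = cdom c, cmap c' = G \o c &
    forall d, compatible c d -> compatible c' d].
Proof.
move=> [SG SG' GK G'K].
have cG y : {for y, continuous G} by apply: (Ck_continuous (SG 0%N)).
have cG' y : {for y, continuous G'} by apply: (Ck_continuous (SG' 0%N)).
have imE A : (G \o c) @` A = G' @^-1` (c @` A).
  apply/seteqP; split=> [_ [p Ap <-]|y [p Ap E]] /=; first by exists p; rewrite ?GK.
  by exists p; rewrite //= E G'K.
have oG' A : open A -> open (G' @^-1` A).
  by apply: open_comp => y _; exact: cG'.
have h1 : open ((G \o c) @` cdom c) by rewrite imE; apply: oG'; exact: open_cimg.
have h2 p : cdom c p -> (cinv c \o G') ((G \o c) p) = p.
  by move=> cp; rewrite /= GK cmapK.
have h3 p : cdom c p -> {for p, continuous (G \o c)}.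
  move=> cp; apply: continuous_comp; first exact: cmap_continuous.
  exact: cG.
have h4 y : ((G \o c) @` cdom c) y -> {for y, continuous (cinv c \o G')}.
  rewrite imE => cy; apply: continuous_comp; first exact: cG'.
  exact: cinv_continuous.
exists (Chart (open_cdom c) h1 h2 h3 h4); split=> // d [S1 S2]; split=> k /=.
- have oU : open (c @` (cdom c `&` cdom d)).
    by rewrite setIC; apply: open_chart_image; exact: open_cdom.
  have oV : open ((G \o c) @` (cdom c `&` cdom d)) by rewrite imE; exact: oG'.
  rewrite compA; apply: (Ck_comp oV oU) (S1 k) _; first by move=> y; rewrite imE.
  exact: Ck_sub (SG' k).
- have oU : open (d @` (cdom c `&` cdom d)).
    by apply: open_chart_image; exact: open_cdom.
  rewrite -compA; exact: (Ck_comp oU openT) (SG k) (S2 k).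
Qed.

Lemma local_coords_comp (M : manifold R n) (a : M) (x : M -> 'rV[R]_n)
    (G G' : 'rV[R]_n -> 'rV[R]_n) :
  diffeo G G' -> local_coords a x -> local_coords a (G \o x).
Proof.
move=> GG' [c [ca cc <-]]; have [c' [dE mE cE]] := chart_comp c GG'.
by exists c'; split; rewrite ?dE// => p; apply: cE.
Qed.

Lemma affine_diffeo (b : 'rV[R]_n) (B : 'M[R]_n) : B \in unitmx ->
  diffeo (fun y => (y - b) *m invmx B) (fun y => y *m B + b).
Proof.
move=> uB.
have Sm (A : 'M[R]_n) k : Ck k setT (fun y : 'rV[R]_n => y *m A).
  apply/Ck_rVP; first exact: openT.
  move=> j; have cS : Ck k setT (fun y : 'rV[R]_n => \sum_i A i j * y 0 i : R^o).
    apply: Ck_sum; first exact: openT.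
    by move=> i _; apply: CkZ; [exact: openT|exact: Ck_coord].
  apply: Ck_ext cS; first exact: openT.
  by move=> y _; rewrite mxE; apply: eq_bigr => i _; rewrite mulrC.
have St (v : 'rV[R]_n) k : Ck k setT (fun y : 'rV[R]_n => y + v).
  by apply: CkD; [exact: openT|apply: Ck_id; exact: openT|exact: Ck_cst].
split.
- by move=> k; apply: (Ck_comp openT openT _ (Sm (invmx B) k) (St (- b) k)).
- by move=> k; apply: (Ck_comp openT openT _ (St b k) (Sm B k)).
- by move=> y; rewrite mulmxKV// subrK.
- by move=> y; rewrite addrK mulmxK.
Qed.

(* The correction to the [k]-th coordinate only involves coordinates of smaller
   weight, so that the inverse of the map at [z] is the limit of the iteration
   [y |-> z - (F y - y)], which is stationary after [s] steps. *)
Lemma triangular_diffeo (s : nat) (w : 'I_n -> nat)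
    (A : 'I_n -> {ffun 'I_n -> 'I_s.+1} -> R)
    (Q : 'I_n -> pred {ffun 'I_n -> 'I_s.+1})
    (F : 'rV[R]_n -> 'rV[R]_n) :
  (forall k, 0 < w k <= s)%N ->
  (forall k al, Q k al -> (\sum_i w i * al i < w k)%N) ->
  (forall y k, F y 0 k = y 0 k +
     \sum_(al | Q k al) A k al * \prod_(i < n) y 0 i ^+ al i) ->
  exists F', diffeo F F'.
Proof.
move=> ws Qw FE.
pose p (y : 'rV[R]_n) : 'rV[R]_n :=
  \row_k \sum_(al | Q k al) A k al * \prod_(i < n) y 0 i ^+ al i.
have FEp y : F y = y + p y by apply/rowP => k; rewrite FE !mxE.
have Sp k : Ck k setT p.
  apply/Ck_rVP; first exact: openT.
  move=> j; have cS : Ck k setT (fun y : 'rV[R]_n =>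
      \sum_(al | Q j al) A j al * \prod_(i < n) y 0 i ^+ al i : R^o).
    apply: Ck_sum; first exact: openT.
    move=> al _; apply: CkZ; first exact: openT.
    apply: Ck_prod; first exact: openT.
    by move=> i _; apply: CkX; [exact: openT|exact: Ck_coord].
  by apply: Ck_ext cS; [exact: openT|move=> y _; rewrite mxE].
pose E (z y : 'rV[R]_n) : 'rV[R]_n := z - p y.
(* Each iteration gains one weight: a variable with positive exponent in the correction of
   coordinate i has weight < w_i. *)
have E_agree m (z y y' : 'rV[R]_n) : (forall i, (w i <= m)%N -> y 0 i = y' 0 i) ->
    forall i, (w i <= m.+1)%N -> E z y 0 i = E z y' 0 i.
  move=> yy' i wi; rewrite !mxE; congr (_ - _); apply: eq_bigr => al Qal.
  congr (_ * _); apply: eq_bigr => j _.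
  have [->|aj] := posnP (al j); first by rewrite !expr0.
  rewrite yy'// -ltnS (leq_trans _ wi)//; apply: leq_trans (Qw _ _ Qal).
  by rewrite ltnS (bigD1 j)//= (leq_trans _ (leq_addr _ _))// leq_pmulr.
(* No coordinate has weight 0, which starts the induction, and all have weight at most s, so s
   iterations forget the starting point. *)
have it_agree z y y' : iter s (E z) y = iter s (E z) y'.
  suff ag m i : (w i <= m)%N -> iter m (E z) y 0 i = iter m (E z) y' 0 i.
    by apply/rowP => i; apply: ag; case/andP: (ws i).
  elim: m i => [|m IH] i; first by rewrite leqNgt; case/andP: (ws i) => ->.
  by rewrite /=; apply: E_agree.
pose F' z := iter s (E z) 0.
exists F'; split.
- move=> k; have := CkD openT (Ck_id k openT) (Sp k).
  by apply: Ck_ext; [exact: openT|move=> y _; rewrite FEp].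
- move=> k; rewrite /F'; elim: (X in iter X) => [|m IH]; first exact: Ck_cst.
  have Spm : Ck k setT (fun z => p (iter m (E z) 0)).
    exact: (Ck_comp openT openT _ (Sp k) IH).
  have SN : Ck k setT (fun z => - p (iter m (E z) 0)).
    apply/Ck_rVP; first exact: openT.
    move=> j; have := CkZ (-1) openT ((Ck_rVP _ _ openT).1 Spm j).
    by apply: Ck_ext; [exact: openT|move=> y _; rewrite mulN1r [RHS]mxE].
  exact: CkD openT (Ck_id k openT) SN.
(* The iteration may start at y, a fixed point of [E (F y)]. *)
- move=> y; rewrite /F' (it_agree _ _ y); have Ey : E (F y) y = y.
    by rewrite /E FEp addrK.
  exact: iter_fix.
(* One more iteration only changes the starting point, so [F' z] is a fixed point of [E z]. *)
- move=> z; have Fx : E z (F' z) = F' z 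
    by rewrite /F' -iterS iterSr; exact: it_agree.
  by rewrite FEp -{1}Fx /E subrK.
Qed.

End ChartChange.

(** * Privileged coordinates *)

Section Coordinates.
Context (R : realType) (n : nat) (M : manifold R n) (c : chart R n M).
Hypothesis cc : forall p, compatible c (chart_at p).

Lemma chart_comp_smooth (V : set M) (G : 'rV[R]_n -> R^o) :
  open V -> V `<=` cdom c -> smooth_on setT G -> smooth_fun V (fun p => G (c p)).
Proof.
move=> oV Vc SG q k; have oU := @open_chart_image _ _ _ (chart_at q) _ oV.
apply: (Ck_comp_scalar oU openT _ (SG k)) => //.
apply: Ck_sub ((cc q).2 k) => _ [p [Vp qp] <-].
by exists p => //; split=> //; exact: Vc.
Qed.

Lemma tangent_map_comp (W : normedModType R) (G : 'rV[R]_n -> W) p v :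
  cdom c p -> differentiable G (c p) ->
  tangent_map (fun q => G (c q)) p v = 'D_(tangent_map c p v) G (c p).
Proof.
move=> cp dG; set phi := chart_at p; have pp : cdom phi p := mem_chart_at p.
have dT : differentiable (c \o cinv phi) (phi p).
  exact: transition_differentiable (compatible_sym (cc p)) pp cp.
have E : (c \o cinv phi) (phi p) = c p by rewrite /= cmapK.
rewrite -E in dG.
by rewrite /tangent_map -[in RHS]E -(derive_comp v dT dG).
Qed.

End Coordinates.

Lemma derive_affine (R : realType) n (A : 'M[R]_n) (b z v : 'rV[R]_n) :
  'D_v (fun y : 'rV[R]_n => (y - b) *m A) z = v *m A.
Proof.
rewrite (derive_shiftE (fun y : 'rV[R]_n => y *m A) (- b) z v).
have -> : (fun y : 'rV[R]_n => y *m A) = (mulmxr A : 'rV[R]_n -> 'rV[R]_n).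
  by [].
have cA : continuous (mulmxr A : 'rV[R]_n -> 'rV[R]_n).
  move=> y; apply: continuous_rVP => j.
  have cS : Ck 0 setT (fun y : 'rV[R]_n => \sum_i y 0 i * A i j : R^o).
    apply: Ck_sum; first exact: openT.
    move=> i _; apply: CkM; [exact: openT|exact: Ck_coord|exact: Ck_cst].
  have cS' : Ck 0 setT (fun y : 'rV[R]_n => mulmxr A y 0 j : R^o).
    apply: Ck_ext cS; first exact: openT.
    by move=> x _; rewrite /= mxE.
  exact: Ck_continuous cS' _.
by rewrite (deriveE _ (linear_differentiable _ cA)) diff_lin.
Qed.

Section Privileged.
Context (R : realType) (n : nat) (M : carnot_manifold R n) (a : M)
  (V : set M) (X : 'I_n -> M -> 'rV[R]_n) (c : chart R n M).
Hypothesis oV : open V.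
Hypothesis Va : V a.
Hypothesis hX : H_frame V X.
Hypothesis Vc : V `<=` cdom c.
Hypothesis cc : forall p, compatible c (chart_at p).

Let B := frame_matrix X a c.

Lemma frame_matrix_unit : B \in unitmx.
Proof.
have [J uJ EJ] := tangent_map_mx (cc a) (Vc Va).
have -> : B = (\matrix_k X k a) *m J.
  apply/row_matrixP => j; rewrite row_mul -EJ.
  by apply/rowP => k; rewrite !mxE rowK.
by rewrite unitmx_mul uJ (basis_unitmx (hX.2 _ Va)).
Qed.

Let T := T_map X a c.

Lemma T_map_diffeo : exists T', diffeo T T'.
Proof. by eexists; exact: affine_diffeo frame_matrix_unit. Qed.

(** The linearly adapted coordinates to which the algebraic results are applied. *)
Let y k (p : M) : R := T (c p) 0 k.

Let DS : derivations V (smooth_fun V) (fun i => vf_act (X i)).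
Proof. by apply: vf_act_derivations => // i; exact: (hX.1 i).1. Qed.

Let Sy k : smooth_fun V (y k).
Proof.
have [T' [ST _ _ _]] := T_map_diffeo.
apply: (chart_comp_smooth cc oV Vc (G := fun z => T z 0 k)) => r.
exact: ((Ck_rVP _ _ openT).1 (ST r) k).
Qed.

Let y0 k : y k a = 0.
Proof. by rewrite /y /T /T_map subrr mul0mx mxE. Qed.

Lemma vf_act_comp (P : 'rV[R]_n -> 'rV[R]_n) i k : smooth_on setT P ->
  vf_act (X i) (fun p => P (c p) 0 k) a = tangent_map (P \o c) a (X i a) 0 k.
Proof.
move=> SP; have ca := Vc Va.
have dP : differentiable P (c a) by exact: (Ck_differentiable_rV openT (SP 1%N)).
have dPk : differentiable (fun z => P z 0 k : R^o) (c a).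
  exact: (Ck_differentiable openT ((Ck_rVP _ _ openT).1 (SP 1%N) k)).
rewrite /vf_act (tangent_map_comp cc (G := fun z => P z 0 k : R^o))//.
rewrite (tangent_map_comp cc (G := P))//.
by rewrite (derive_rVE _ (diff_derivable dP)).
Qed.

(** Row i of B is the coordinate vector of X_i(a); T sends it to row i of B B^-1. *)
Let Dy i k : vf_act (X i) (y k) a = (i == k)%:R.
Proof.
have [T' [ST _ _ _]] := T_map_diffeo.
rewrite (vf_act_comp i k ST); have ca := Vc Va.
rewrite (tangent_map_comp cc (G := T)) //; last first.
  exact: (Ck_differentiable_rV openT (ST 1%N)).
rewrite derive_affine.
have -> : tangent_map c a (X i a) = row i B by apply/rowP => l; rewrite !mxE.
by rewrite -row_mul (mulmxV frame_matrix_unit) row1 mxE eqxx eq_sym.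
Qed.

Let w_gt0 i : (0 < weight M i)%N := weight_gt0 a i.

Let Nm k : (weight M k <= (step M).+1)%N := leqW (weight_le_step a k).

(** Below weight w_k <= r the bracket condition of the filtration always applies. *)
Let brackets k i j : (weight M i + weight M j < weight M k)%N ->
  structure_functions V (smooth_fun V) (fun i => vf_act (X i)) (weight M) i j.
Proof.
move=> ijk; apply: (@frame_brackets _ _ _ _ _ oV hX a i j Va).
exact: leq_trans (ltnW ijk) (weight_le_step a k).
Qed.

Let Dyk k i : (weight M i < weight M k)%N -> vf_act (X i) (y k) a = 0.
Proof. by move=> ik; rewrite Dy; case: eqP ik => // ->; rewrite ltnn. Qed.

Let corr k := @correction R M n (weight M) (weight M k) (step M) y (y k).

Definition psi_hat_coeffs (A : 'I_n -> {ffun 'I_n -> 'I_(step M).+1} -> R)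
    (P : 'rV[R]_n -> 'rV[R]_n) : Prop :=
  forall z k, P z 0 k = z 0 k +
    \sum_(al : {ffun 'I_n -> 'I_(step M).+1} |
       (mi_weight al < weight M k)%N && (2 <= mi_length al)%N)
      A k al * \prod_(i < n) z 0 i ^+ al i.

Lemma psi_hat_correction P A : psi_hat_coeffs A P ->
  forall k, (fun p => (P \o T \o c) p 0 k) = corr k (A k).
Proof. by move=> PE k; apply/funext => p; rewrite /= PE. Qed.

Lemma psi_hat_form_diffeo P : psi_hat_form M P -> exists P', diffeo P P'.
Proof.
move=> [A PE]; apply: (triangular_diffeo (w := weight M) _ _ PE).
- by move=> k; rewrite w_gt0 (weight_le_step a).
- by move=> k al /andP[].
Qed.

(** Only the lower bound on the orders has to be checked. Linear adaptedness comes from words of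
    length at most 1, and the order is exactly w_k because the one-letter word k takes the value 1
    on the k-th coordinate. *)
Lemma is_psi_hat_intro P A : psi_hat_coeffs A P ->
  (forall k, order_ge X a (corr k (A k)) (weight M k)) ->
  is_psi_hat X a c P.
Proof.
move=> PE ord; have formP : psi_hat_form M P by exists A.
split=> //; have corrE := psi_hat_correction PE.
have [P' dP] := psi_hat_form_diffeo formP.
have [T' dT] := T_map_diffeo.
have dPT := diffeo_comp dT dP; have [SPT _ _ _] := dPT.
have D1 i k : vf_act (X i) (corr k (A k)) a = (i == k)%:R.
  rewrite -Dy.
  exact: (act_correction_short DS (weight M) (weight M k) Va Sy y0 Dy (Sy k)
    (A k) (s := [:: i]) isT).
split; first split.
- by apply: local_coords_comp dPT _; exists c; split=> //; exact: Vc.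
- apply/rowP => k; rewrite mxE -[LHS]/((fun p => (P \o T \o c) p 0 k) a) corrE.
  rewrite -(y0 k).
  exact: (act_correction_short DS (weight M) (weight M k) Va Sy y0 Dy (Sy k)
    (A k) (s := [::]) isT).
- move=> j; apply/rowP => k; rewrite -[P \o _ \o _]/((P \o T) \o c).
  rewrite -(vf_act_comp j k SPT) mxE eqxx /= eq_sym -D1 -corrE.
  by [].
move=> k; rewrite corrE; split; first exact: ord.
exists [:: k]; first by rewrite /seq_weight big_seq1.
by rewrite /frame_act /= D1 eqxx oner_eq0.
Qed.

Lemma is_psi_hat_exists : exists P, is_psi_hat X a c P.
Proof.
have /choice[A HA] : forall k, exists A, order_ge X a (corr k A) (weight M k).
  move=> k; exact: (correction_exists DS Va w_gt0 (Nm k) (@brackets k) Sy y0 Dy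
    (Sy k) (y0 k) (@Dyk k)).
exists (fun z => \row_k (z 0 k +
  \sum_(al : {ffun 'I_n -> 'I_(step M).+1} |
     (mi_weight al < weight M k)%N && (2 <= mi_length al)%N)
    A k al * \prod_(i < n) z 0 i ^+ al i)).
by apply: (is_psi_hat_intro (A := A)) => // z k; rewrite mxE.
Qed.

(** P depends only on its admissible coefficients, and these solve the triangular system. *)
Lemma is_psi_hat_unique P P' :
  is_psi_hat X a c P -> is_psi_hat X a c P' -> P = P'.
Proof.
move=> [[A PE] [_ ordP]] [[A' PE'] [_ ordP']].
apply/funext => z; apply/rowP => k; rewrite PE PE'; congr (_ + _).
have [h1 _] := ordP k; have [h2 _] := ordP' k.
rewrite (psi_hat_correction PE) in h1; rewrite (psi_hat_correction PE') in h2.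
apply: eq_bigr => al Pal; congr (_ * _).
exact: (correction_unique DS Va w_gt0 (Nm k) (@brackets k) Sy y0 Dy
    (Sy k) (y0 k) (@Dyk k) h1 h2 Pal).
Qed.

End Privileged.

Lemma H_frame_sub (R : realType) n (M : carnot_manifold R n) (V V' : set M)
    (X : 'I_n -> M -> 'rV[R]_n) : V' `<=` V -> H_frame V X -> H_frame V' X.
Proof.
move=> VV' [SX bX]; split=> [j|p /VV'/bX //]; have [SXj XH] := SX j.
split=> [q k|p /VV'/XH //]; apply: Ck_sub (SXj q k).
by move=> _ [p [Vp qp] <-]; exists p => //; split=> //; exact: VV'.
Qed.

Theorem proposition3p23 (R : realType) (n : nat) (M : carnot_manifold R n)
  (a : M) (V : set M) (aV : open_nbhs a V)
  (X : 'I_n -> M -> 'rV[R]_n) (hX : H_frame V X)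
  (x : M -> 'rV[R]_n) (hx : local_coords a x) :
  privileged X a (psi X a x \o x).
Proof.
have [c [ca cc cx]] := hx; have [oV Va] := aV.
(* The conclusion concerns the point a alone, so the frame may be restricted to the chart domain. *)
have oV' : open (V `&` cdom c) by apply: openI => //; exact: open_cdom.
have V'a : (V `&` cdom c) a by [].
have hX' : H_frame (V `&` cdom c) X by apply: H_frame_sub hX => p [].
have V'c : V `&` cdom c `<=` cdom c by move=> p [].
have [P HP] := is_psi_hat_exists oV' V'a hX' V'c cc.
(* Unique existence ensures that [get] in [psi_hat] returns the intended map instead of a default
   value. *)
have uP : exists P, unique (is_psi_hat X a c) P.
  by exists P; split=> // P'; exact: (is_psi_hat_unique oV' V'a hX' V'c cc).
have [[_ priv] _] := getPex uP.
by rewrite -cx; exact: priv.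
Qed.
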